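(* Let $b>0$ and $M>0$. There exist constants $c>0$ and $C_0>0$, depending only on $b$ and $M$, such that the following holds. Let $A,N$ be dyadic with $1\le A\le cN$, let $L_1,L_2,L_3>0$ and let $f_i:\mathbb{R}\times\mathbb{Z}^2/N\to\mathbb{R}$, $i=1,2,3$. For $i=1,2,3$ let $S_i=\{(\psi_i(\xi),\xi)\,:\,\xi\in\mathbb{R}^2\}$ be hypersurfaces with $\psi_i\in C^{1,1}(\mathbb{R}^2)$ and $\|\nabla\psi_i\|_{L^\infty}\le M$. Suppose that the unit normal vector fields $\mathfrak{n}_i$ on $S_i$ satisfy $$\sup_{\sigma,\tilde\sigma\in S_i}\ \frac{|\mathfrak{n}_i(\sigma)-\mathfrak{n}_i(\tilde\sigma)|}{|\sigma-\tilde\sigma|}+\frac{|\mathfrak{n}_i(\sigma)\cdot(\sigma-\tilde\sigma)|}{|\sigma-\tilde\sigma|^{2}}\le b ,\qquad i=1,2,3,$$ and that $$A^{-1}\le\det\big(\mathfrak{n}_1(\sigma_1),\mathfrak{n}_2(\sigma_2),\mathfrak{n}_3(\sigma_3)\big)\le 1\qquad\text{for all }(\sigma_1,\sigma_2,\sigma_3)\in S_1\times S_2\times S_3 .$$ Suppose that $$\operatorname{supp}(f_i)\subseteq S_i(L_i):=\{(\tau,k)\in\mathbb{R}\times\mathbb{Z}^2/N\,:\,|\tau-\psi_i(k)|\le L_i\},\qquad i=1,2,3.$$ Then $$N^4\left|\int_{\mathbb{R}\times(\mathbb{Z}^2/N)}(f_1*f_2)\,f_3\,d\tau\,(dk)_N\right|\le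 C_0\; C(A,N,L_1,L_2,L_3)\prod_{i=1}^3\big(N\|f_i\|_{L^2_\tau L^2_{(dk)_N}}\big),$$ where $$C(A,N,L_1,L_2,L_3)=L_{\min}^{1/2}\,\langle N L_{\mathrm{med}}\rangle^{1/2}\,\langle A N L_{\max}\rangle^{1/2}.$$
   Context: Dyadic numbers are elements of $2^{\mathbb{N}_0}$. $\langle x\rangle=(1+|x|^2)^{1/2}$. $\mathbb{Z}^2/N=(\mathbb{Z}/N)^2=\{k/N: k\in\mathbb{Z}^2\}$, and $(dk)_N$ is the normalized counting measure on it: $\int a(k)\,(dk)_N=N^{-2}\sum_{k\in\mathbb{Z}^2/N}a(k)$. The convolution on $\mathbb{R}\times\mathbb{Z}^2/N$ is taken with respect to $d\tau\,(dk)_N$: $(f_1*f_2)(\tau,k)=\int\int f_1(\tau',k')f_2(\tau-\tau',k-k')\,d\tau'\,(dk')_N$, and $\|f\|_{L^2_\tau L^2_{(dk)_N}}^2=\int\int|f|^2\,d\tau\,(dk)_N$. $L_{\min}\le L_{\mathrm{med}}\le L_{\max}$ is the increasing rearrangement of $L_1,L_2,L_3$. *)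

(* Defs.v *)
From HB Require Import structures.
From mathcomp Require Export all_boot all_order all_algebra.
From mathcomp Require Export all_classical all_reals all_analysis.

Set Implicit Arguments.
Unset Strict Implicit.
Unset Printing Implicit Defensive.

Import Order.TTheory GRing.Theory Num.Theory.
Import numFieldNormedType.Exports.

Local Open Scope classical_set_scope.
Local Open Scope ring_scope.

Definition dyadic (n : nat) : Prop := exists j : nat, n = (2 ^ j)%N.

Definition jbracket (R : realType) (x : R) : R := Num.sqrt (1 + x ^+ 2).

(* The library norm on row vectors is the sup norm, hence these. *)
Definition dotp (R : realType) (n : nat) (u v : 'rV[R]_n) : R :=
  \sum_(i < n) u 0 i * v 0 i.

Definition enorm (R : realType) (n : nat) (u : 'rV[R]_n) : R :=
  Num.sqrt (dotp u u).

(* [Z^2/N = {m/N : m in Z^2}], coded by [m]; the point itself is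
   [lattice_pt m]. *)
Definition lattice (N : nat) : Type := 'rV[int]_2.

HB.instance Definition _ (N : nat) := Countable.on (lattice N).
HB.instance Definition _ (N : nat) := GRing.Zmodule.on (lattice N).
HB.instance Definition _ (N : nat) := isPointed.Build (lattice N) 0.
HB.instance Definition _ (N : nat) :=
  @isMeasurable.Build default_measure_display (lattice N) discrete_measurable
    discrete_measurable0 discrete_measurableC discrete_measurableU.

Definition lattice_pt (R : realType) (N : nat) (m : lattice N) : 'rV[R]_2 :=
  \row_j ((m 0 j)%:~R / N%:R).

Section lattice_measure.
Context (R : realType) (N : nat).

Definition dk : set (lattice N) -> \bar R :=
  mscale (N%:R ^- 2)%:nng counting.

HB.instance Definition _ := Measure.on dk.

Let sigma_finite_dk : sigma_finite setT dk.
Proof.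
exists (fun i => [set m : lattice N | pickle m = i]).
  by apply/seteqP; split=> // m _; exists (pickle m).
move=> i; split=> //.
rewrite /dk /mscale /=.
have fin : finite_set [set m : lattice N | pickle m = i].
  have [[m0 m0i]|no] := pselect (exists m : lattice N, pickle m = i).
    apply: (@sub_finite_set _ _ [set m0]) => // m /= mi.
    by apply: (pcan_inj (@pickleK _)); rewrite mi m0i.
  by rewrite (_ : mkset _ = set0)//; apply/seteqP; split=> // m mi;
    case: no; exists m.
by rewrite /counting asboolT//= -EFinM ltry.
Qed.

HB.instance Definition _ := @Measure_isSigmaFinite.Build _ _ _ dk sigma_finite_dk.

(* [measurableTypeR R] is [R] with the Borel sigma-algebra on which the
   library puts [lebesgue_measure]. *)
Definition dtaudk : set (measurableTypeR R * lattice N) -> \bar R :=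
  (lebesgue_measure \x dk)%E.

HB.instance Definition _ := Measure.on dtaudk.

Definition conv (f g : measurableTypeR R * lattice N -> R)
    (z : measurableTypeR R * lattice N) : \bar R :=
  (\int[dtaudk]_w (f w * g ((z.1 : R) - (w.1 : R), z.2 - w.2)%R)%:E)%E.

End lattice_measure.

Section hypersurfaces.
Context (R : realType).
Implicit Types (psi : 'rV[R]_2 -> R) (nu : 'rV[R]_3 -> 'rV[R]_3).

Definition grad psi (xi : 'rV[R]_2) : 'rV[R]_2 :=
  \row_j 'D_(delta_mx 0 j) psi xi.

(* No boundedness of [psi] is part of this: only its gradient matters. *)
Definition C11 psi : Prop :=
  (forall xi, differentiable psi xi) /\ lipschitz (grad psi).

Definition graph_pt psi (xi : 'rV[R]_2) : 'rV[R]_3 :=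
  row_mx (psi xi)%:M xi.

Definition hypersurface psi : set 'rV[R]_3 := range (graph_pt psi).

(* [row_mx ('D_v psi xi)%:M v], for [v] in R^2, are the tangent vectors at
   [graph_pt psi xi].  Both orientations are allowed. *)
Definition unit_normal_field psi nu : Prop :=
  forall xi, enorm (nu (graph_pt psi xi)) = 1 /\
    forall v : 'rV[R]_2,
      dotp (nu (graph_pt psi xi)) (row_mx ('D_v psi xi)%:M v) = 0.

Definition normal_bound psi nu (b : R) : Prop :=
  forall s t, hypersurface psi s -> hypersurface psi t -> s != t ->
    enorm (nu s - nu t) / enorm (s - t)
      + `|dotp (nu s) (s - t)| / enorm (s - t) ^+ 2 <= b.

Definition thickening (N : nat) psi (L : R) :
    set (measurableTypeR R * lattice N) :=
  [set z | `|(z.1 : R) - psi (lattice_pt R z.2)| <= L].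

End hypersurfaces.

Section constant.
Context (R : realType).

Definition Lsort (L : 'I_3 -> R) (i : nat) : R :=
  nth 0 (sort <=%R (codom L)) i.
Definition Lmin (L : 'I_3 -> R) : R := Lsort L 0.
Definition Lmed (L : 'I_3 -> R) : R := Lsort L 1.
Definition Lmax (L : 'I_3 -> R) : R := Lsort L 2.

Definition Cconst (A N : nat) (L : 'I_3 -> R) : R :=
  Num.sqrt (Lmin L) * Num.sqrt (jbracket (N%:R * Lmed L))
    * Num.sqrt (jbracket (A%:R * N%:R * Lmax L)).

End constant.

(* Main.v *)
From HB Require Import structures.
Require Import Defs.
From mathcomp Require Import measurable_realfun ring lra.
Import Order.TTheory GRing.Theory Num.Theory.
Import numFieldNormedType.Exports.
Local Open Scope classical_set_scope.
Local Open Scope ring_scope.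

Set Implicit Arguments.
Unset Strict Implicit.
Unset Printing Implicit Defensive.

(** The left side is at most [N^4] times the trilinear form
    [T = int int |f_0|(w) |f_1|(z - w) |f_2|(z) dw dz].  Let the pivot be the
    index of [L_min]; suppose first that it is [2].  Two applications of
    Cauchy-Schwarz, one in [w] and one in [z], give
    [T^2 <= K |f_0|_2^2 |f_1|_2^2 |f_2|_2^2], where [K] is the supremum over
    [v, w] of the measure of the points [z] lying within the thickened [S_2],
    the thickened [S_1] translated by [w] and the thickened [S_0] translated
    by [v] ([trilinear_cauchy_schwarz]).  The indicators of the three supports
    must be kept inside the integrals for this to be a bound at all.

    For a fixed lattice point [k] the admissible [tau] fill an interval of
    length at most [2 L_min], so [K] is at most [2 L_min / N^2] times the
    number of lattice points [k] at which
    [psi_1(k - w) - psi_2(k)] and [psi_0(k - v) - psi_2(k)] lie in intervals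
    of lengths comparable to [L_1] and [L_0] ([triple_intersection_le]).
    All that remains is to count lattice points in the intersection of two
    curved strips, and to find at most a constant times
    [(1 + N L_med) (1 + A N L_max)] of them ([size_intersection]).

    Transversality enters as follows.  By the mean value theorem, the
    increment of each [psi_i] between two points is the product of the
    displacement with the gradient of [psi_i] at some point.  These three
    points differ, but the determinant condition holds for all triples of
    points, and the gradient of [psi_2] is the same in both differences.  So
    Cramer's rule applies to any two points of the intersection: if both
    strips have width [e / N] with [e <= 1], then in lattice units the
    intersection has diameter at most of order [e A g], where [g] is the
    largest entry of the two gradients at a point of it ([dist1_cramer]).  Since the
    gradients are Lipschitz (the normals are) and [A <= c N], they vary by
    less than a fraction of [g] over that diameter, so that on each line in
    the coordinate direction of the largest entry the points fill a length of
    order [e / g] ([size_strip]).  The count [(1 + e A g) (1 + e / g)] is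
    [O(1 + A e)] because [g] is at most [2 M] and [A g^2] is bounded below
    ([size_thin_intersection]).  Wider strips are cut into unit ones.

    If the pivot is [0] or [1], the form [T] is rewritten with the functions
    permuted and one of them reflected through the origin
    ([trilinear_exchange], [trilinear_rotate]); a reflection replaces [psi] by
    [- psi(- .)], which has the same set of gradients. *)

(** * Counting by fibres *)

Lemma path_lt_int_size (x : int) (s : seq int) :
  path <%R x s -> x + (size s)%:Z <= last x s.
Proof.
elim: s x => [|y s IHs] x /=; first by rewrite addr0.
move=> /andP[xy /IHs]; apply: le_trans.
by rewrite -add1n PoszD addrA lerD2r lezD1.
Qed.

Lemma uniq_int_size (R : realType) (s : seq int) (X : R) :
  0 <= X -> uniq s -> (forall x y, x \in s -> y \in s -> (x - y)%:~R <= X) ->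
  (size s)%:R <= 1 + X.
Proof.
move=> X0 us sX.
have: sorted <%R (sort <=%R s) by rewrite lt_sorted_uniq_le sort_uniq us sort_le_sorted.
have := size_sort <=%R s; have := mem_sort <=%R s.
case: (sort _ s) => [_ <- _|x t ms <- /= /path_lt_int_size xt].
  by rewrite addr_ge0.
rewrite -natr1 addrC lerD2l.
apply: (le_trans _ (sX (last x t) x _ _)); last 2 first.
- by rewrite -ms mem_last.
- by rewrite -ms mem_head.
by rewrite pmulrn ler_int lerBrDl.
Qed.

Lemma size_le_fibres (R : realType) (T : eqType) (h : T -> int) (s : seq T)
    (X F : R) :
  0 <= X -> uniq s ->
  (forall x y, x \in s -> y \in s -> (h x - h y)%:~R <= X) ->
  (forall i, (size [seq x <- s | h x == i])%:R <= F) ->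
  (size s)%:R <= (1 + X) * F.
Proof.
move=> X0 us sX sF.
have F0 : 0 <= F by apply: le_trans (sF 0); rewrite ler0n.
have values : (size (undup (map h s)))%:R <= 1 + X.
  apply: uniq_int_size => //; first exact: undup_uniq.
  move=> i j; rewrite !mem_undup => /mapP[x xs ->] /mapP[y ys ->].
  exact: sX.
apply: (le_trans _ (ler_wpM2r F0 values)).
have: all (fun x => h x \in undup (map h s)) s.
  by apply/allP => x xs; rewrite mem_undup map_f.
move: (undup (map h s)) => t; elim: t s sF {us sX values} => [|i t IHt] s sF.
  by case: s sF => [|x s] _ //=; rewrite mul0r.
move=> /allP st.
have -> : size s = (size [seq x <- s | h x == i] + size [seq x <- s | h x != i])%N.
  by rewrite !size_filter count_predC.
rewrite natrD /= -natr1 mulrDl mul1r addrC lerD//; apply: IHt.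
  move=> j; apply: le_trans (sF j); rewrite ler_nat -filter_predI !size_filter.
  by apply: sub_count => x /= /andP[].
apply/allP => x; rewrite mem_filter => /andP[hx /st].
by rewrite inE (negbTE hx).
Qed.

Lemma ord2 (j : 'I_2) : j = 0 \/ j = 1.
Proof. by case: j => -[|[|//]] j2; [left|right]; apply/val_inj. Qed.

(** * Lattice points in the intersection of two strips *)

Section slopes.
Context (R : realType).
Local Notation point := 'rV[int]_2.
Local Notation vec := 'rV[R]_2.
Implicit Types (m n : point) (p q : vec) (Psi : point -> R) (D : point -> vec).

Definition incr p m n : R :=
  p 0 0 * (n 0 0 - m 0 0)%:~R + p 0 1 * (n 0 1 - m 0 1)%:~R.

Definition dist1 m n : R := `|(n 0 0 - m 0 0)%:~R| + `|(n 0 1 - m 0 1)%:~R|.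

Definition cross p q : R := p 0 0 * q 0 1 - p 0 1 * q 0 0.

(** The trace on the lattice of the mean value theorem for a function with
    Lipschitz gradient: [Q] stands for the set of its gradients and [D] for
    the gradient at the lattice points.  The slope [q] comes from an unknown
    intermediate point; keeping [Q] instead of that point makes transversality
    a statement about three sets, unaffected by translations and
    reflections. *)
Definition has_slopes Psi (Q : set vec) (delta : R) :=
  exists D, forall m n,
    (exists q, [/\ Q q, Psi n - Psi m = incr q m n &
       forall j, `|q 0 j - D m 0 j| <= delta * dist1 m n]) /\
    (forall j, `|D m 0 j - D n 0 j| <= delta * dist1 m n).

Lemma dist1_ge0 m n : 0 <= dist1 m n.
Proof. exact: addr_ge0. Qed.

(** Cramer's rule for the system with rows [p], [q] whose unknown is the
    displacement from [m] to [n]. *)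
Lemma dist1_cramer p q m n (A e K : R) : 0 < A -> 0 <= e ->
  A^-1 <= `|cross p q| -> `|incr p m n| <= e -> `|incr q m n| <= e ->
  (forall j, `|p 0 j| <= K) -> (forall j, `|q 0 j| <= K) ->
  dist1 m n <= 4 * (e * A * K).
Proof.
move=> A0 e0 dpq pe qe pK qK; rewrite /dist1.
set x := (n 0 0 - m 0 0)%:~R; set y := (n 0 1 - m 0 1)%:~R.
have bound (z : R) (a b : R) : cross p q * z = incr p m n * a - incr q m n * b ->
    `|a| <= K -> `|b| <= K -> `|z| <= 2 * (e * A * K).
  move=> zE aK bK.
  have zle : `|cross p q| * `|z| <= 2 * (e * K).
    rewrite -normrM zE (le_trans (ler_normB _ _))// !normrM mulr_natl mulr2n.
    by rewrite lerD// ler_pM.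
  have -> : 2 * (e * A * K) = A * (2 * (e * K)) by ring.
  by rewrite -ler_pdivrMl// (le_trans _ zle)// ler_wpM2r.
have -> : 4 * (e * A * K) = 2 * (e * A * K) + 2 * (e * A * K) by ring.
rewrite lerD//.
- apply: (bound x (q 0 1) (p 0 1)) => //.
  by rewrite /incr /cross -/x -/y; ring.
- apply: (bound y (- q 0 0) (- p 0 0)); rewrite ?normrN//.
  by rewrite /incr /cross -/x -/y; ring.
Qed.

(** Over the whole of [s] the slope of [W] in the direction [j] stays above
    [g / 2]: three variations of at most [g / 8] are allowed for.  Hence [W]
    can stay within [e] only along a segment of length [2 * e / g] in that
    direction, while the other coordinate takes at most [1 + 2 * r] values. *)
Lemma size_strip (W : point -> R) (DW : point -> vec) (s : seq point) x0
    (j j' : 'I_2) (e g delta r : R) :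
  (j, j') = (0, 1) \/ (j, j') = (1, 0) ->
  0 <= e -> 0 < g -> 0 <= delta -> 0 <= r ->
  (forall m n, exists p, W n - W m = incr p m n /\
    `|p 0 j - DW m 0 j| <= delta * dist1 m n) ->
  (forall m n, `|DW m 0 j - DW n 0 j| <= delta * dist1 m n) ->
  uniq s -> x0 \in s -> `|DW x0 0 j| = g ->
  (forall m n, m \in s -> n \in s -> `|W n - W m| <= e) ->
  (forall m, m \in s -> dist1 x0 m <= r) ->
  delta * r <= g / 8 ->
  (size s)%:R <= (1 + 2 * r) * (1 + 2 * e / g).
Proof.
move=> jj e0 g0 d0 r0 slope lip us x0s DWg We sr dr.
have dist2 m n : m \in s -> n \in s -> dist1 m n <= 2 * r.
  move=> ms ns; have := sr _ ms; have := sr _ ns; rewrite /dist1.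
  rewrite !intrB; set a := (m 0 0)%:~R; set b := (m 0 1)%:~R.
  set c := (n 0 0)%:~R; set d := (n 0 1)%:~R.
  set x := (x0 0 0)%:~R; set y := (x0 0 1)%:~R.
  have := ler_distD x c a; have := ler_distD y d b.
  by rewrite (distrC x) (distrC y); lra.
have coordle m n i : `|(n 0 i - m 0 i)%:~R| <= dist1 m n.
  rewrite /dist1; have [->|->] := ord2 i.
  - by rewrite lerDl.
  - by rewrite lerDr.
apply: (@size_le_fibres _ _ (fun m => m 0 j')) => //.
- by rewrite mulr_ge0.
- move=> m n ms ns; apply: le_trans (ler_norm _) _.
  by apply: le_trans (coordle _ _ _) _; exact: dist2.
move=> i.
set t := [seq x : point <- s | x 0 j' == i].
have injj : {in t &, injective (fun m : point => m 0 j)}.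
  move=> m n; rewrite !mem_filter => /andP[/eqP mi _] /andP[/eqP ni _] mn.
  apply/rowP => k.
  have [->|->] := ord2 k.
  - by case: jj mi ni mn => -[-> ->] // -> ->.
  - by case: jj mi ni mn => -[-> ->] // -> ->.
have -> : size t = size (map (fun m : point => m 0 j) t) by rewrite size_map.
apply: uniq_int_size.
- by rewrite divr_ge0 ?mulr_ge0// ltW.
- by rewrite map_inj_in_uniq// filter_uniq.
move=> _ _ /mapP[n nt ->] /mapP[m mt ->].
have [ni ns] : n 0 j' = i /\ n \in s by move: nt; rewrite mem_filter => /andP[/eqP].
have [mi ms] : m 0 j' = i /\ m \in s by move: mt; rewrite mem_filter => /andP[/eqP].
have [p [Wp pD]] := slope m n.
have {}Wp : W n - W m = p 0 j * (n 0 j - m 0 j)%:~R.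
  rewrite Wp /incr; case: jj mi ni => -[-> ->] mi ni.
  - by rewrite ni mi subrr mulr0 addr0.
  - by rewrite ni mi subrr mulr0 add0r.
have pg : g / 2 <= `|p 0 j|.
  have l1 := lip x0 m.
  have d1 : delta * dist1 x0 m <= g / 8.
    by apply: le_trans dr; rewrite ler_wpM2l// sr.
  have d2 : delta * dist1 m n <= 2 * (g / 8).
    apply: (@le_trans _ _ (delta * (2 * r))); first by rewrite ler_wpM2l// dist2.
    by rewrite mulrCA ler_wpM2l.
  have := ler_distD (DW m 0 j) (DW x0 0 j) (p 0 j).
  have := lerB_dist (DW x0 0 j) (p 0 j).
  by rewrite DWg (distrC (DW m 0 j)); lra.
apply: le_trans (ler_norm _) _; rewrite ler_pdivlMr//.
have h : g / 2 * `|(n 0 j - m 0 j)%:~R| <= e.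
  by apply: le_trans (We _ _ ms ns); rewrite Wp normrM ler_wpM2r.
lra.
Qed.

(** Each displacement has slopes [p] of [U] and [q] of [V] that are transversal
    to each other, although neither is the slope at a common point. *)
Definition transversal_slopes (U V : point -> R) (A delta G : R) :=
  exists DU DV : point -> vec, [/\
    forall m n, exists p q,
      [/\ U n - U m = incr p m n, V n - V m = incr q m n,
          A^-1 <= `|cross p q|,
          forall j, `|p 0 j - DU m 0 j| <= delta * dist1 m n &
          forall j, `|q 0 j - DV m 0 j| <= delta * dist1 m n],
    forall m n j, `|DU m 0 j - DU n 0 j| <= delta * dist1 m n,
    forall m n j, `|DV m 0 j - DV n 0 j| <= delta * dist1 m n,
    forall m j, `|DU m 0 j| <= G &
    forall m j, `|DV m 0 j| <= G].

Lemma dist1xx m : dist1 m m = 0.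
Proof. by rewrite /dist1 !subrr normr0 addr0. Qed.

(** Cramer's rule bounds the diameter by a multiple of [e * A * g], [g] being
    the largest entry of the slopes at [x0]; in the direction of that entry
    [size_strip] applies.  The terms linear in [g] and in [1 / g] of the
    resulting product are bounded by multiples of [G * (A * e)], the latter since
    the cross product at [x0] forces [1 <= 2 * A * g ^ 2]. *)
Lemma size_thin_intersection (U V : point -> R) (A delta G e : R) (s : seq point) :
  transversal_slopes U V A delta G -> 1 <= A -> 0 <= delta ->
  A * delta <= 1 / 64 -> 0 <= e <= 1 -> uniq s ->
  (forall m n, m \in s -> n \in s -> `|U n - U m| <= e) ->
  (forall m n, m \in s -> n \in s -> `|V n - V m| <= e) ->
  (size s)%:R <= 1 + (20 * G + 32) * (A * e).
Proof.
move=> [DU [DV [slope lipU lipV DUG DVG]]] A1 d0 Ad /andP[e0 e1] us Us Vs.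
have A0 : 0 < A by apply: lt_le_trans A1.
have G0 : 0 <= G by apply: le_trans (DUG 0 0).
have Ae0 : 0 <= A * e by rewrite mulr_ge0// ltW.
have GAe0 : 0 <= G * (A * e) by rewrite mulr_ge0.
case: s us Us Vs => [|x0 s'] us Us Vs; first by rewrite /=; lra.
set s := x0 :: s' in us Us Vs *.
have x0s : x0 \in s by rewrite mem_head.
have [g [gE gU gV]] : exists g, [/\ exists j, `|DU x0 0 j| = g \/ `|DV x0 0 j| = g,
    forall j, `|DU x0 0 j| <= g & forall j, `|DV x0 0 j| <= g].
  have [j0 j0P] : exists j0, forall j, `|DU x0 0 j| <= `|DU x0 0 j0|.
    by exists [arg max_(j > 0) `|DU x0 0 j|]%O; case: arg_maxP => //= i _ + j; exact.
  have [j1 j1P] : exists j1, forall j, `|DV x0 0 j| <= `|DV x0 0 j1|.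
    by exists [arg max_(j > 0) `|DV x0 0 j|]%O; case: arg_maxP => //= i _ + j; exact.
  have [le|/ltW le] := leP `|DU x0 0 j0| `|DV x0 0 j1|.
  - exists `|DV x0 0 j1|; split=> [|j|//]; first by exists j1; right.
    exact: le_trans (j0P _) le.
  - exists `|DU x0 0 j0|; split=> [|//|j]; first by exists j0; left.
    exact: le_trans (j1P _) le.
have g0 : 0 <= g by apply: le_trans (gU 0).
have gG : g <= G by case: gE => j [<-|<-].
(* Transversality for the trivial displacement from [x0] to itself. *)
have gA : A^-1 <= 2 * g ^+ 2.
  have [p [q [_ _ pq pU qV]]] := slope x0 x0.
  have pE j : p 0 j = DU x0 0 j.
    by have := pU j; rewrite dist1xx mulr0 normr_le0 subr_eq0 => /eqP.
  have qE j : q 0 j = DV x0 0 j.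
    by have := qV j; rewrite dist1xx mulr0 normr_le0 subr_eq0 => /eqP.
  apply: le_trans pq _; rewrite /cross !pE !qE.
  rewrite (le_trans (ler_normB _ _))// !normrM mulr_natl mulr2n expr2.
  by rewrite lerD// ler_pM.
have {g0} g_gt0 : 0 < g.
  rewrite lt_neqAle g0 andbT; apply/eqP => gz.
  by move: gA; rewrite -gz expr0n mulr0 leNgt invr_gt0 A0.
have gV1 : g^-1 <= 2 * (A * g).
  rewrite -(ler_pM2l g_gt0) mulfV ?gt_eqF//.
  have -> : g * (2 * (A * g)) = A * (2 * g ^+ 2) by ring.
  by rewrite -ler_pdivrMl// mulr1.
have diam m : m \in s -> dist1 x0 m <= 8 * (e * A * g).
  move=> ms; have [p [q [Up Vq pq pU qV]]] := slope x0 m.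
  (* The right side contains the distance, but with a coefficient at most
     [4 / 64], so that it is absorbed. *)
  have : dist1 x0 m <= 4 * (e * A * (g + delta * dist1 x0 m)).
    apply: dist1_cramer pq _ _ _ _ => //.
    - by rewrite -Up; exact: Us.
    - by rewrite -Vq; exact: Vs.
    - move=> j; have := ler_distD (DU x0 0 j) (p 0 j) 0.
      by rewrite !subr0; have := gU j; have := pU j; lra.
    - move=> j; have := ler_distD (DV x0 0 j) (q 0 j) 0.
      by rewrite !subr0; have := gV j; have := qV j; lra.
  have : e * (A * delta) * dist1 x0 m <= 1 / 64 * dist1 x0 m.
    rewrite ler_wpM2r ?dist1_ge0// -[leRHS]mul1r.
    by rewrite ler_pM// mulr_ge0// ltW.
  have := dist1_ge0 x0 m.
  have : 0 <= e * A * g by rewrite !mulr_ge0// ltW.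
  have -> : 4 * (e * A * (g + delta * dist1 x0 m)) =
    4 * (e * A * g) + 4 * (e * (A * delta) * dist1 x0 m) by ring.
  by lra.
have dr : delta * (8 * (e * A * g)) <= g / 8.
  have : e * (A * delta) * g <= 1 / 64 * g.
    rewrite ler_wpM2r ?(ltW g_gt0)// -[leRHS]mul1r.
    by rewrite ler_pM// mulr_ge0// ltW.
  have -> : delta * (8 * (e * A * g)) = 8 * (e * (A * delta) * g) by ring.
  lra.
have : (size s)%:R <= (1 + 2 * (8 * (e * A * g))) * (1 + 2 * e / g).
  have r0 : 0 <= 8 * (e * A * g) by rewrite !mulr_ge0// ltW.
  case: gE => j gj.
  have [j' jj] : exists j' : 'I_2, (j, j') = (0, 1) \/ (j, j') = (1, 0).
    have [->|->] := ord2 j.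
    - by exists 1; left.
    - by exists 0; right.
  case: gj => gj.
  - apply: (size_strip jj e0 g_gt0 d0 r0 _ _ us x0s gj Us diam dr).
      by move=> m n; have [p [q [? ? ? ? ?]]] := slope m n; exists p.
    by move=> m n; exact: lipU.
  - apply: (size_strip jj e0 g_gt0 d0 r0 _ _ us x0s gj Vs diam dr).
      by move=> m n; have [p [q [? ? ? ? ?]]] := slope m n; exists q.
    by move=> m n; exact: lipV.
move/le_trans; apply.
have -> : (1 + 2 * (8 * (e * A * g))) * (1 + 2 * e / g) =
  1 + 16 * (g * (A * e)) + 2 * (e / g) + 32 * (A * e * e).
  by field; rewrite gt_eqF.
have h1 : g * (A * e) <= G * (A * e) by rewrite ler_wpM2r.
have h2 : e / g <= 2 * (G * (A * e)).
  apply: (@le_trans _ _ (e * (2 * (A * g)))); first by rewrite ler_wpM2l.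
  have -> : e * (2 * (A * g)) = 2 * (g * (A * e)) by ring.
  lra.
have h3 : A * e * e <= A * e by rewrite ler_piMr.
lra.
Qed.

(** If the wider strip has width at most one, then both are as thin as
    [size_thin_intersection] requires.  Otherwise there are at most
    [(2 + e1) * (2 + e2)] pairs of unit strips, and each contributes [O(A)]
    points. *)
Lemma size_intersection (U V : point -> R) (A delta G e1 e2 : R) (s : seq point) :
  transversal_slopes U V A delta G -> 1 <= A -> 0 <= delta ->
  A * delta <= 1 / 64 -> 0 <= e1 -> 0 <= e2 -> uniq s ->
  (forall m n, m \in s -> n \in s -> `|U n - U m| <= e1) ->
  (forall m n, m \in s -> n \in s -> `|V n - V m| <= e2) ->
  (size s)%:R <=
    6 * (20 * G + 33) * ((1 + Num.min e1 e2) * (1 + A * Num.max e1 e2)).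
Proof.
move=> tr A1 d0 Ad e10 e20 us Us Vs.
have A0 : 0 < A by apply: lt_le_trans A1.
have G0 : 0 <= G.
  by have [DU [DV [_ _ _ DUG _]]] := tr; apply: le_trans (DUG 0 0).
have mM : Num.min e1 e2 * Num.max e1 e2 = e1 * e2.
  by have [le|/ltW le] := leP e1 e2; rewrite // mulrC.
have m0 : 0 <= Num.min e1 e2 by rewrite le_min e10.
have mM_sum : Num.min e1 e2 + Num.max e1 e2 = e1 + e2.
  by have [le|/ltW le] := leP e1 e2; rewrite // addrC.
have e1M : e1 <= Num.max e1 e2 by rewrite le_max lexx.
have e2M : e2 <= Num.max e1 e2 by rewrite le_max lexx orbT.
move: mM m0 mM_sum e1M e2M.
set l := Num.min e1 e2; set h := Num.max e1 e2 => mM l0 lh e1h e2h.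
have h0 : 0 <= h by apply: le_trans e1h.
have Ah0 : 0 <= A * h by rewrite mulr_ge0// ltW.
have GAh0 : 0 <= G * (A * h) by rewrite mulr_ge0.
have [h1|/ltW h1] := leP h 1.
  apply: (@le_trans _ _ (1 + (20 * G + 32) * (A * h))).
    apply: (size_thin_intersection tr) => //; first by rewrite h0.
    - by move=> m n ms ns; apply: le_trans e1h; exact: Us.
    - by move=> m n ms ns; apply: le_trans e2h; exact: Vs.
  have c0 : 0 <= 20 * G + 32 by lra.
  have c1 : 0 <= l * (1 + A * h) by rewrite mulr_ge0//; lra.
  apply: (@le_trans _ _ (6 * (20 * G + 33) * (1 + A * h))); first lra.
  by rewrite ler_wpM2l//; lra.
(* The unit strips are the fibres of the integer parts of [U] and [V]. *)
have slice (W : point -> R) e (t : seq point) :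
    (forall m n, m \in t -> n \in t -> `|W n - W m| <= e) ->
    forall m n, m \in t -> n \in t ->
      (Num.floor (W m) - Num.floor (W n))%:~R <= 1 + e.
  move=> Wt m n mt nt; have := Wt _ _ nt mt => /ler_normlP[_ +].
  have := floor_le (W m); have := floorD1_gt (W n).
  by rewrite intrB intrD; lra.
have same (W : point -> R) i m n :
    Num.floor (W m) == i -> Num.floor (W n) == i -> `|W n - W m| <= 1.
  move=> /eqP mi /eqP ni.
  have := floor_le (W m); have := floorD1_gt (W m).
  have := floor_le (W n); have := floorD1_gt (W n).
  by rewrite mi ni intrD ler_norml; lra.
apply: (@le_trans _ _ ((2 + e1) * ((2 + e2) * (1 + (20 * G + 32) * A)))).
  have -> : 2 + e1 = 1 + (1 + e1) by ring.
  apply: (size_le_fibres (h := Num.floor \o U)) => //; first lra.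
    exact: slice.
  move=> i; have -> : 2 + e2 = 1 + (1 + e2) by ring.
  apply: (size_le_fibres (h := Num.floor \o V)) => //; first lra.
  - by rewrite filter_uniq.
  - apply: slice => m n; rewrite !mem_filter => /andP[_ ms] /andP[_ ns].
    exact: Vs.
  move=> k; rewrite -[leRHS](_ : 1 + (20 * G + 32) * (A * 1) = _); last first.
    by rewrite mulr1.
  apply: (size_thin_intersection tr) => //; first by rewrite ler01 lexx.
  - by rewrite !filter_uniq.
  - move=> m n; rewrite !mem_filter => /and3P[_ mi _] /and3P[_ ni _].
    exact: same mi ni.
  - move=> m n; rewrite !mem_filter => /and3P[mi _ _] /and3P[ni _ _].
    exact: same mi ni.
rewrite mulrA.
have -> : (2 + e1) * (2 + e2) = 4 + 2 * (e1 + e2) + e1 * e2 by ring.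
rewrite -mM -lh.
have l_h : l * 1 <= l * h by rewrite ler_wpM2l.
have f1 : 4 + 2 * (l + h) + l * h <= 6 * ((1 + l) * h) by lra.
have f2 : 1 + (20 * G + 32) * A <= (20 * G + 33) * A by lra.
apply: (@le_trans _ _ (6 * ((1 + l) * h) * ((20 * G + 33) * A))).
  rewrite ler_pM// addr_ge0//.
  - by rewrite addr_ge0// mulr_ge0//; lra.
  - by rewrite mulr_ge0.
  - by rewrite mulr_ge0//; lra.
have -> : 6 * ((1 + l) * h) * ((20 * G + 33) * A) =
  6 * (20 * G + 33) * ((1 + l) * (A * h)) by ring.
rewrite ler_wpM2l; [by []|lra|].
rewrite ler_wpM2l//; lra.
Qed.

(** The cross product is the determinant of the rows [(1, q1)], [(1, q2)],
    [(1, q3)], hence symmetric in the three sets up to sign. *)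
Definition transversal (Q1 Q2 Q3 : set vec) (A : R) := forall q1 q2 q3,
  Q1 q1 -> Q2 q2 -> Q3 q3 -> A^-1 <= `|cross (q1 - q3) (q2 - q3)|.

Lemma has_slopes_shift Psi Q delta (a : point) :
  has_slopes Psi Q delta -> has_slopes (fun m => Psi (m - a)) Q delta.
Proof.
have sub m n (i : 'I_2) :
    (n - a : point) 0 i - (m - a : point) 0 i = n 0 i - m 0 i.
  by rewrite !mxE opprD opprK addrACA addNr addr0.
move=> [D DP]; exists (fun m => D (m - a)) => m n.
by have := DP (m - a) (n - a); rewrite /incr /dist1 !sub.
Qed.

Lemma has_slopes_reflect Psi Q delta :
  has_slopes Psi Q delta -> has_slopes (fun m => - Psi (- m)) Q delta.
Proof.
have sub m n (i : 'I_2) :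
    (- n : point) 0 i - (- m : point) 0 i = - (n 0 i - m 0 i).
  by rewrite !mxE opprB opprK addrC.
move=> [D DP]; exists (fun m => D (- m)) => m n.
have [[q [Qq Pq qD]] DD] := DP (- m) (- n).
have dE : dist1 (- m) (- n) = dist1 m n.
  by rewrite /dist1 !sub !mulrNz !normrN.
split; last by rewrite -dE.
exists q; split=> //; last by rewrite -dE.
rewrite -opprB opprK addrC Pq /incr !sub !mulrNz.
by rewrite !mulrN -opprD opprK.
Qed.

(** The same slope [q3] of [Psi3] serves both differences: this is what makes
    the transversality of the three sets applicable to them. *)
Lemma has_slopes_diff (Psi1 Psi2 Psi3 : point -> R) Q1 Q2 Q3 (A delta M : R) :
  has_slopes Psi1 Q1 delta -> has_slopes Psi2 Q2 delta ->
  has_slopes Psi3 Q3 delta ->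
  transversal Q1 Q2 Q3 A ->
  (forall q j, Q1 q -> `|q 0 j| <= M) ->
  (forall q j, Q2 q -> `|q 0 j| <= M) ->
  (forall q j, Q3 q -> `|q 0 j| <= M) ->
  transversal_slopes (fun m => Psi1 m - Psi3 m) (fun m => Psi2 m - Psi3 m)
    A (2 * delta) (2 * M).
Proof.
have bounded Psi Q D : (forall m n,
      (exists q, [/\ Q q, Psi n - Psi m = incr q m n &
         forall j, `|q 0 j - D m 0 j| <= delta * dist1 m n]) /\
      (forall j, `|D m 0 j - D n 0 j| <= delta * dist1 m n)) ->
    (forall q j, Q q -> `|q 0 j| <= M) -> forall m j, `|D m 0 j| <= M.
  move=> DP QM m j; have [[q [Qq _ qD]] _] := DP m m.
  by have := qD j; rewrite dist1xx mulr0 normr_le0 subr_eq0 => /eqP <-; exact: QM.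
move=> [D1 P1] [D2 P2] [D3 P3] trans M1 M2 M3.
have {}M1 := bounded _ _ _ P1 M1; have {}M2 := bounded _ _ _ P2 M2.
have {}M3 := bounded _ _ _ P3 M3.
have triangle (x y z t d : R) : `|x - y| <= d -> `|z - t| <= d ->
    `|(x - z) - (y - t)| <= 2 * d.
  by move=> xy zt; rewrite ler_norml; move: xy zt; rewrite !ler_norml; lra.
exists (fun m => D1 m - D3 m), (fun m => D2 m - D3 m); split.
- move=> m n.
  have [[q1 [Qq1 e1 d1]] _] := P1 m n; have [[q2 [Qq2 e2 d2]] _] := P2 m n.
  have [[q3 [Qq3 e3 d3]] _] := P3 m n.
  exists (q1 - q3), (q2 - q3); split.
  + transitivity ((Psi1 n - Psi1 m) - (Psi3 n - Psi3 m)); first by ring.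
    by rewrite e1 e3 /incr !mxE; ring.
  + transitivity ((Psi2 n - Psi2 m) - (Psi3 n - Psi3 m)); first by ring.
    by rewrite e2 e3 /incr !mxE; ring.
  + exact: trans.
  + by move=> j; rewrite !mxE -mulrA triangle.
  + by move=> j; rewrite !mxE -mulrA triangle.
- move=> m n j; rewrite !mxE -mulrA triangle//.
  + by have [_] := P1 m n.
  + by have [_] := P3 m n.
- move=> m n j; rewrite !mxE -mulrA triangle//.
  + by have [_] := P2 m n.
  + by have [_] := P3 m n.
- move=> m j; rewrite !mxE (le_trans (ler_normB _ _))// mulr_natl mulr2n.
  by rewrite lerD.
- move=> m j; rewrite !mxE (le_trans (ler_normB _ _))// mulr_natl mulr2n.
  by rewrite lerD.
Qed.

End slopes.

(** * Two applications of the Cauchy-Schwarz inequality *)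

Section ereal_squares.
Context (R : realType).
Local Open Scope ereal_scope.
Implicit Types x y : \bar R.

Lemma mule_le_half_squares x y : 0 <= x -> 0 <= y ->
  x * y <= (2^-1)%:E * (x * x + y * y).
Proof.
case: x => [x| |]; case: y => [y| |]; rewrite ?lee_fin// => x0 y0.
- by have := sqr_ge0 (x - y)%R; lra.
- by rewrite mulyy addey// [leRHS]gt0_muley ?leey// lte_fin invr_gt0.
- by rewrite mulyy addye// [leRHS]gt0_muley ?leey// lte_fin invr_gt0.
- by rewrite mulyy addye// [leRHS]gt0_muley ?leey// lte_fin invr_gt0.
Qed.

Lemma lee_sqr x y : 0 <= x -> 0 <= y -> x * x <= y * y -> x <= y.
Proof.
move=> x0 y0; case: (leP x y) => // yx.
have yfin : y \is a fin_num by rewrite ge0_fin_numE// (lt_le_trans yx)// leey.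
rewrite leNgt => /negP[].
case: x y x0 y0 yx yfin => [x| |] [y| |]// x0 y0 yx _.
- by rewrite -!EFinM lte_fin -!expr2 ltrXn2r// lt_eqF.
- by rewrite mulyy -EFinM ltry.
Qed.

End ereal_squares.

Section cauchy_schwarz.
Context d (T : measurableType d) (R : realType).
Context (mu : {measure set T -> \bar R}).
Local Open Scope ereal_scope.

(** Integrating [2 F(x) G(x) F(y) G(y) <= F(x)^2 G(y)^2 + G(x)^2 F(y)^2] over
    both variables proves the inequality for extended-real functions, whatever
    the values of the integrals.  Infinite values do occur below: the inner
    integral of a trilinear form is such a function. *)
Lemma ge0_cauchy_schwarz (F G : T -> \bar R) :
  measurable_fun setT F -> measurable_fun setT G ->
  (forall x, 0 <= F x) -> (forall x, 0 <= G x) ->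
  (\int[mu]_x (F x * G x)) * (\int[mu]_x (F x * G x)) <=
  (\int[mu]_x (F x * F x)) * (\int[mu]_x (G x * G x)).
Proof.
move=> mF mG F0 G0.
have mM (f g : T -> \bar R) : measurable_fun setT f -> measurable_fun setT g ->
    measurable_fun setT (fun x => f x * g x) by exact: emeasurable_funM.
have M0 (f g : T -> \bar R) x : (forall x, 0 <= f x) -> (forall x, 0 <= g x) ->
  0 <= f x * g x by move=> f0 g0; exact: mule_ge0.
have I0 (f : T -> \bar R) : (forall x, 0 <= f x) -> 0 <= \int[mu]_x f x.
  by move=> f0; apply: integral_ge0.
have prod (f g : T -> \bar R) : measurable_fun setT f -> measurable_fun setT g ->
    (forall x, 0 <= f x) -> (forall x, 0 <= g x) ->
    (\int[mu]_x f x) * (\int[mu]_x g x) = \int[mu]_x \int[mu]_y (f x * g y).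
  move=> mf mg f0 g0.
  rewrite -ge0_integralZr//; last exact: I0.
  by apply: eq_integral => x _; rewrite ge0_integralZl.
set f2 := fun x => F x * F x; set g2 := fun x => G x * G x.
set fg := fun x => F x * G x.
rewrite prod; [|exact: mM|exact: mM|by move=> x; exact: M0|by move=> x; exact: M0].
have sym : \int[mu]_x \int[mu]_y (g2 x * f2 y) =
    (\int[mu]_x f2 x) * (\int[mu]_x g2 x).
  rewrite -prod; [exact: muleC|exact: mM|exact: mM| |]; by move=> x; exact: M0.
have asym : \int[mu]_x \int[mu]_y (f2 x * g2 y) =
    (\int[mu]_x f2 x) * (\int[mu]_x g2 x).
  rewrite -prod; [by []|exact: mM|exact: mM| |]; by move=> x; exact: M0.
set X := _ * _.
have mI (f g : T -> \bar R) : measurable_fun setT f -> measurable_fun setT g ->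
    (forall x, 0 <= f x) -> (forall x, 0 <= g x) ->
    measurable_fun setT (fun x => \int[mu]_y (f x * g y)).
  move=> mf mg f0 g0.
  rewrite (_ : (fun _ => _) = (fun x => f x * \int[mu]_y g y)); last first.
    by apply/funext => x; rewrite ge0_integralZl.
  by apply: emeasurable_funM => //; exact: measurable_cst.
have f20 x : 0 <= f2 x by exact: M0.
have g20 x : 0 <= g2 x by exact: M0.
have fg0 x : 0 <= fg x by exact: M0.
have mf2 : measurable_fun setT f2 by exact: mM.
have mg2 : measurable_fun setT g2 by exact: mM.
have mfg : measurable_fun setT fg by exact: mM.
have mh x : measurable_fun setT (fun y => f2 x * g2 y + g2 x * f2 y).
  by apply: emeasurable_funD; apply: emeasurable_funM => //; exact: measurable_cst.
have h0 x y : 0 <= f2 x * g2 y + g2 x * f2 y by rewrite adde_ge0// mule_ge0.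
have hE x : \int[mu]_y (f2 x * g2 y + g2 x * f2 y) =
    \int[mu]_y (f2 x * g2 y) + \int[mu]_y (g2 x * f2 y).
  apply: ge0_integralD => //; try by move=> y _; exact: mule_ge0.
  - by apply: emeasurable_funM => //; exact: measurable_cst.
  - by apply: emeasurable_funM => //; exact: measurable_cst.
apply: (@le_trans _ _ (\int[mu]_x \int[mu]_y
    ((2^-1)%:E * (f2 x * g2 y + g2 x * f2 y)))).
  apply: ge0_le_integral => //.
  - by move=> x _; apply: I0 => y; exact: (mule_ge0 (fg0 x) (fg0 y)).
  - exact: (mI fg fg).
  - rewrite (_ : (fun _ => _) = (fun x => (2^-1)%:E *
        (\int[mu]_y (f2 x * g2 y) + \int[mu]_y (g2 x * f2 y)))); last first.
      apply/funext => x; by rewrite ge0_integralZl// hE.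
    apply: emeasurable_funM; first exact: measurable_cst.
    by apply: emeasurable_funD; exact: mI.
  - move=> x _; apply: ge0_le_integral => //.
    + by move=> y _; exact: (mule_ge0 (fg0 x) (fg0 y)).
    + by apply: (emeasurable_funM _ mfg); exact: measurable_cst.
    + by apply: emeasurable_funM => //; exact: measurable_cst.
    + move=> y _; rewrite /f2 /g2 /fg.
      have -> : F x * G x * (F y * G y) = (F x * G y) * (G x * F y).
        by rewrite muleACA [G x * _]muleC [RHS]muleACA (muleC (G y)) muleACA.
      have -> : F x * F x * (G y * G y) = (F x * G y) * (F x * G y).
        by rewrite muleACA.
      have -> : G x * G x * (F y * F y) = (G x * F y) * (G x * F y).
        by rewrite muleACA.
      by apply: mule_le_half_squares; exact: mule_ge0.
under eq_integral => x _.
  rewrite ge0_integralZl ?lee_fin ?invr_ge0// hE.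
  over.
rewrite ge0_integralZl ?lee_fin ?invr_ge0//; last 2 first.
- by apply: emeasurable_funD; exact: mI.
- by move=> x _; apply: adde_ge0; apply: I0 => y; exact: mule_ge0.
rewrite ge0_integralD//; last 4 first.
- by move=> x _; apply: I0 => y; exact: mule_ge0.
- exact: mI.
- by move=> x _; apply: I0 => y; exact: mule_ge0.
- exact: mI.
rewrite asym sym -/X.
have X0 : 0 <= X by rewrite mule_ge0// I0.
case: X X0 => [x| |] //= x0; last by rewrite leey.
by rewrite -EFinD -EFinM lee_fin; lra.
Qed.

End cauchy_schwarz.

Section trilinear.
Context d (T : measurableType d) (R : realType).
Context (mu : {sigma_finite_measure set T -> \bar R}) (sub : T -> T -> T).
Local Open Scope ereal_scope.

Definition trilinear (a b c : T -> \bar R) :=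
  \int[mu]_z \int[mu]_w (a w * b (sub z w) * c z).

Hypothesis msub : measurable_fun setT (fun p : T * T => sub p.1 p.2).
Hypothesis subK : forall z, involutive (sub z).
Hypothesis integral_sub : forall z (f : T -> \bar R), measurable_fun setT f ->
  (forall x, 0 <= f x) -> \int[mu]_w f (sub z w) = \int[mu]_w f w.

Lemma measurable_subr z : measurable_fun setT (sub z).
Proof. exact: (measurable_fun_pair2 (f := fun p => sub p.1 p.2)). Qed.

Lemma measurable_subl w : measurable_fun setT (sub^~ w).
Proof. exact: (measurable_fun_pair1 (f := fun p => sub p.1 p.2)). Qed.

Lemma measurable_fun_integral2 (F : T * T -> \bar R) :
  measurable_fun setT F -> (forall p, 0 <= F p) ->
  measurable_fun setT (fun z => \int[mu]_w F (z, w)).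
Proof. by move=> mF F0; exact: (measurable_fun_fubini_tonelli_F (m2 := mu) F). Qed.

(** The functions [x1], [x2], [x3] are indicators of sets containing the
    supports.  The first Cauchy-Schwarz inequality is in [z]; the second one,
    in [w], distributes the indicators so that [a^2] goes with [x2 x3] and
    [b^2] with [x1].  After the substitution [v = z - w] in the second factor,
    integrating in [z] first leaves exactly the triple intersection [K]. *)
Lemma trilinear_cauchy_schwarz (a b c x1 x2 x3 : T -> \bar R) (K : \bar R) :
  measurable_fun setT a -> measurable_fun setT b -> measurable_fun setT c ->
  measurable_fun setT x1 -> measurable_fun setT x2 -> measurable_fun setT x3 ->
  (forall z, 0 <= a z) -> (forall z, 0 <= b z) -> (forall z, 0 <= c z) ->
  (forall z, 0 <= x1 z) -> (forall z, 0 <= x2 z) -> (forall z, 0 <= x3 z) ->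
  (forall z, x1 z * x1 z = x1 z) -> (forall z, x2 z * x2 z = x2 z) ->
  (forall z, x3 z * x3 z = x3 z) ->
  (forall z, a z * x1 z = a z) -> (forall z, b z * x2 z = b z) ->
  (forall z, c z * x3 z = c z) -> 0 <= K ->
  (forall w v, \int[mu]_z (x3 z * x2 (sub z w) * x1 (sub z v)) <= K) ->
  trilinear a b c * trilinear a b c <=
  K * ((\int[mu]_z (a z * a z)) * (\int[mu]_z (b z * b z)) *
       (\int[mu]_z (c z * c z))).
Proof.
move=> ma mb mc mx1 mx2 mx3 a0 b0 c0 x10 x20 x30 i1 i2 i3 ax bx cx K0 xK.
have mM (f g : T -> \bar R) : measurable_fun setT f -> measurable_fun setT g ->
    measurable_fun setT (fun x => f x * g x) by exact: emeasurable_funM.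
have mM2 (f g : T * T -> \bar R) : measurable_fun setT f -> measurable_fun setT g ->
    measurable_fun setT (fun x => f x * g x) by exact: emeasurable_funM.
have m1 (f : T -> \bar R) : measurable_fun setT f ->
    measurable_fun setT (fun p : T * T => f p.1).
  by move=> mf; exact: (measurableT_comp mf measurable_fst).
have m2 (f : T -> \bar R) : measurable_fun setT f ->
    measurable_fun setT (fun p : T * T => f p.2).
  by move=> mf; exact: (measurableT_comp mf measurable_snd).
have ms (f : T -> \bar R) : measurable_fun setT f ->
    measurable_fun setT (fun p : T * T => f (sub p.1 p.2)).
  by move=> mf; exact: (measurableT_comp mf msub).
have msr (f : T -> \bar R) z : measurable_fun setT f ->
    measurable_fun setT (fun w => f (sub z w)).
  by move=> mf; exact: (measurableT_comp mf (measurable_subr z)).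
have msl (f : T -> \bar R) w : measurable_fun setT f ->
    measurable_fun setT (fun z => f (sub z w)).
  by move=> mf; exact: (measurableT_comp mf (measurable_subl w)).
have I0 (f : T -> \bar R) : (forall x, 0 <= f x) -> 0 <= \int[mu]_x f x.
  by move=> f0; apply: integral_ge0.
pose h z := \int[mu]_w ((a w * (x2 (sub z w) * x3 z)) * (b (sub z w) * x1 w)).
pose P z := \int[mu]_w (a w * a w * (x2 (sub z w) * x3 z)).
pose Q z := \int[mu]_v (b v * b v * x1 (sub z v)).
have h0 z : 0 <= h z by apply: I0 => w; rewrite !mule_ge0.
have P0 z : 0 <= P z by apply: I0 => w; rewrite !mule_ge0.
have Q0 z : 0 <= Q z by apply: I0 => w; rewrite !mule_ge0.
have mh : measurable_fun setT h.
  apply: (measurable_fun_integral2 (F := fun p =>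
    (a p.2 * (x2 (sub p.1 p.2) * x3 p.1)) * (b (sub p.1 p.2) * x1 p.2))).
    by do !apply: (mM2); [exact: (m2 a)|exact: (ms x2)|exact: (m1 x3)|
      exact: (ms b)|exact: (m2 x1)].
  by move=> p; rewrite !mule_ge0.
have mP : measurable_fun setT P.
  apply: (measurable_fun_integral2 (F := fun p =>
    a p.2 * a p.2 * (x2 (sub p.1 p.2) * x3 p.1))).
    by do !apply: (mM2); [exact: (m2 a)|exact: (m2 a)|exact: (ms x2)|exact: (m1 x3)].
  by move=> p; rewrite !mule_ge0.
have mQ : measurable_fun setT Q.
  apply: (measurable_fun_integral2 (F := fun p =>
    b p.2 * b p.2 * x1 (sub p.1 p.2))).
    by do !apply: (mM2); [exact: (m2 b)|exact: (m2 b)|exact: (ms x1)].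
  by move=> p; rewrite !mule_ge0.
have -> : trilinear a b c = \int[mu]_z (c z * h z).
  apply: eq_integral => z _; rewrite /h -ge0_integralZl//; last 2 first.
  - by do !apply: (mM) => //; first [exact: msr | exact: measurable_cst].
  - by move=> w _; rewrite !mule_ge0.
  apply: eq_integral => w _.
  transitivity (a w * x1 w * (b (sub z w) * x2 (sub z w)) * (c z * x3 z)).
    by rewrite ax bx cx.
  rewrite (muleACA (a w)) (muleACA (a w * _)) [in RHS](muleACA (a w)) [RHS]muleA.
  by rewrite (muleC (c z)); congr (_ * _); rewrite [RHS]muleC muleA.
apply: le_trans (ge0_cauchy_schwarz mu mc mh c0 h0) _.
rewrite muleC muleA; apply: lee_wpmul2r.
  by apply: I0 => z; rewrite mule_ge0.
have hPQ z : h z * h z <= P z * Q z.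
  have -> : Q z = \int[mu]_w ((b (sub z w) * x1 w) * (b (sub z w) * x1 w)).
    rewrite /Q -(integral_sub z) => [|//|]; last 2 first.
    - by do !apply: (mM) => //; exact: msr.
    - by move=> w; rewrite !mule_ge0.
    by apply: eq_integral => w _; rewrite subK muleACA i1.
  have -> : P z = \int[mu]_w ((a w * (x2 (sub z w) * x3 z)) *
                              (a w * (x2 (sub z w) * x3 z))).
    by apply: eq_integral => w _; rewrite [RHS]muleACA (muleACA (x2 _)) i2 i3.
  apply: ge0_cauchy_schwarz.
  - by do !apply: (mM) => //; first [exact: msr | exact: measurable_cst].
  - by do !apply: (mM) => //; exact: msr.
  - by move=> w; rewrite !mule_ge0.
  - by move=> w; rewrite !mule_ge0.
apply: (@le_trans _ _ (\int[mu]_z (P z * Q z))).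
  by apply: ge0_le_integral => //; try exact: (mM); move=> z _; rewrite mule_ge0.
set Ia := \int[mu]_z (a z * a z); set Ib := \int[mu]_z (b z * b z).
have Ia0 : 0 <= Ia by apply: I0 => z; rewrite mule_ge0.
have Ib0 : 0 <= Ib by apply: I0 => z; rewrite mule_ge0.
have inner w : \int[mu]_z (x2 (sub z w) * x3 z * Q z) <= K * Ib.
  have -> : \int[mu]_z (x2 (sub z w) * x3 z * Q z) =
      \int[mu]_z \int[mu]_v (x2 (sub z w) * x3 z * (b v * b v * x1 (sub z v))).
    apply: eq_integral => z _; rewrite ge0_integralZl//; last 3 first.
    - by do !apply: (mM) => //; exact: msr.
    - by move=> v _; rewrite !mule_ge0.
    - by rewrite mule_ge0.
  rewrite (fubini_tonelli (m1 := mu) (m2 := mu) (fun p =>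
    x2 (sub p.1 w) * x3 p.1 * (b p.2 * b p.2 * x1 (sub p.1 p.2))))/=; last 2 first.
  - apply: (mM2); first by apply: (mM2); [exact: (m1 _ (msl x2 w mx2))|exact: (m1 x3)].
    by do !apply: (mM2); [exact: (m2 b)|exact: (m2 b)|exact: (ms x1)].
  - by move=> p; rewrite !mule_ge0.
  have -> : K * Ib = \int[mu]_v (b v * b v * K).
    by rewrite ge0_integralZr//; [rewrite muleC|exact: (mM)|move=> v _; rewrite mule_ge0].
  apply: ge0_le_integral => //.
  - by move=> v _; apply: I0 => z; rewrite !mule_ge0.
  - apply: (measurable_fun_integral2 (F := fun p => x2 (sub p.2 w) * x3 p.2 *
      (b p.1 * b p.1 * x1 (sub p.2 p.1)))).
      apply: (mM2); first by apply: (mM2); [exact: (m2 _ (msl x2 w mx2))|exact: (m2 x3)].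
      do !apply: (mM2); [exact: (m1 b)|exact: (m1 b)|].
      exact: (measurableT_comp (ms _ mx1) (@measurable_swap _ _ _ _)).
    by move=> p; rewrite !mule_ge0.
  - by apply: (mM); [exact: (mM)|exact: measurable_cst].
  move=> v _.
  have -> : \int[mu]_z (x2 (sub z w) * x3 z * (b v * b v * x1 (sub z v))) =
      b v * b v * \int[mu]_z (x3 z * x2 (sub z w) * x1 (sub z v)).
    rewrite -ge0_integralZl//; last 3 first.
    - by do !apply: (mM) => //; exact: msl.
    - by move=> z _; rewrite !mule_ge0.
    - by rewrite mule_ge0.
    by apply: eq_integral => z _; rewrite muleCA (muleC (x2 _)).
  by apply: lee_wpmul2l; rewrite ?mule_ge0.
have -> : \int[mu]_z (P z * Q z) =
    \int[mu]_z \int[mu]_w (a w * a w * (x2 (sub z w) * x3 z * Q z)).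
  apply: eq_integral => z _; rewrite -ge0_integralZr//; last 2 first.
  - by do !apply: (mM) => //; first [exact: msr | exact: measurable_cst].
  - by move=> w _; rewrite !mule_ge0.
  by apply: eq_integral => w _; rewrite -muleA.
rewrite (fubini_tonelli (m1 := mu) (m2 := mu) (fun p =>
  a p.2 * a p.2 * (x2 (sub p.1 p.2) * x3 p.1 * Q p.1)))/=; last 2 first.
- by do !apply: (mM2); [exact: (m2 a)|exact: (m2 a)|exact: (ms x2)|
    exact: (m1 x3)|exact: (m1 Q)].
- by move=> p; rewrite !mule_ge0.
have -> : K * (Ia * Ib) = \int[mu]_w (a w * a w * (K * Ib)).
  rewrite ge0_integralZr//; first by rewrite muleCA.
  - exact: (mM).
  - by move=> w _; rewrite mule_ge0.
  - by rewrite mule_ge0.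
apply: ge0_le_integral => //.
- by move=> w _; apply: I0 => z; rewrite !mule_ge0.
- apply: (measurable_fun_integral2 (F := fun p => a p.1 * a p.1 *
    (x2 (sub p.2 p.1) * x3 p.2 * Q p.2))).
    do !apply: (mM2); [exact: (m1 a)|exact: (m1 a)| |exact: (m2 x3)|exact: (m2 Q)].
    exact: (measurableT_comp (ms _ mx2) (@measurable_swap _ _ _ _)).
  by move=> p; rewrite !mule_ge0.
- by apply: (mM); [exact: (mM)|exact: measurable_cst].
move=> w _; rewrite ge0_integralZl//; last 3 first.
- by do !apply: (mM) => //; exact: msl.
- by move=> z _; rewrite !mule_ge0.
- by rewrite mule_ge0.
by apply: lee_wpmul2l; rewrite ?mule_ge0.
Qed.

End trilinear.

(** * Invariance of the product measure *)

Section lattice_space.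
Context (R : realType) (N : nat).
Local Notation Z := (measurableTypeR R * lattice N)%type.

Definition zsub (z w : Z) : Z := ((z.1 : R) - (w.1 : R), z.2 - w.2).

Lemma zsubK z : involutive (zsub z).
Proof. by move=> [t k]; rewrite /zsub /= !subKr. Qed.

(** The product of two countable discrete spaces is discrete, being a countable
    union of products of points. *)
Lemma measurable_lattice_pair d (T : measurableType d)
    (f : lattice N * lattice N -> T) : measurable_fun setT f.
Proof.
move=> _ Y mY; rewrite setTI.
rewrite (_ : _ @^-1` _ = \bigcup_i
    [set p : lattice N * lattice N | Y (f p) /\ pickle p = i]); last first.
  by apply/seteqP; split=> [p Yp|p [i _ []//]]; exists (pickle p).
apply: bigcupT_measurable => i.
have [[[k l] [Yp pi]]|no] :=
  pselect (exists p : lattice N * lattice N, Y (f p) /\ pickle p = i).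
  rewrite (_ : mkset _ = [set k] `*` [set l]); first exact: measurableX.
  apply/seteqP; split=> [p /= [_ pi']|[k' l'] /= [-> ->]//].
  have -> : p = (k, l) by apply: (pcan_inj pickleK); rewrite pi pi'.
  by [].
rewrite (_ : mkset _ = set0)//; apply/seteqP; split=> // p Yp.
by case: no; exists p.
Qed.

Lemma measurable_zsub : measurable_fun setT (fun p : Z * Z => zsub p.1 p.2).
Proof.
apply: measurable_fun_pair.
  apply: (@measurable_funB _ _ R setT (fun p : Z * Z => p.1.1) (fun p : Z * Z => p.2.1)).
  - exact: (measurableT_comp measurable_fst measurable_fst).
  - exact: (measurableT_comp measurable_fst measurable_snd).
have mpair : measurable_fun setT (fun p : Z * Z => (p.1.2, p.2.2)).
  apply: measurable_fun_pair.
  - exact: (measurableT_comp measurable_snd measurable_fst).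
  - exact: (measurableT_comp measurable_snd measurable_snd).
exact: (measurableT_comp (measurable_lattice_pair (fun p => p.1 - p.2)) mpair).
Qed.

Lemma lebesgue_measure_reflect (c : R) (A : set (measurableTypeR R)) :
  measurable A ->
  lebesgue_measure ((fun x : measurableTypeR R => c - x : measurableTypeR R) @^-1` A)
  = lebesgue_measure A :> \bar R.
Proof.
move=> mA.
have mphi : measurable_fun setT
    (fun x : measurableTypeR R => c - x : measurableTypeR R).
  apply: (@measurable_funB _ _ R setT (cst c) (fun x : measurableTypeR R => x)).
    exact: measurable_cst.
  exact: measurable_id.
pose phi : {mfun measurableTypeR R >-> measurableTypeR R} :=
  HB.pack (fun x : measurableTypeR R => c - x : measurableTypeR R)
    (isMeasurableFun.Build _ _ _ _ _ mphi).
apply/esym.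
apply: (@lebesgue_measure_unique R (pushforward lebesgue_measure phi)) => //.
move=> _ [[a b] _ <-].
have preE : phi @^-1` [set` `]a, b]%R] = [set` `[c - b, c - a[%R].
  apply/seteqP; split=> x /=; rewrite !in_itv/=.
    by move=> /andP[? ?]; apply/andP; split; lra.
  by move=> /andP[? ?]; apply/andP; split; lra.
transitivity (lebesgue_measure ([set` `[c - b, c - a[%R] : set R)); last first.
  by rewrite -preE.
rewrite !lebesgue_measure_itv/= !lte_fin ltrD2l ltrN2.
by case: ifP => // _; rewrite -!EFinB; congr EFin; lra.
Qed.

Lemma counting_reflect (c : lattice N) (A : set (lattice N)) :
  counting ((fun k : lattice N => c - k) @^-1` A) = counting A :> \bar R.
Proof.
set phi := fun k : lattice N => c - k.
have phiK : involutive phi by move=> k; exact: subKr.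
have -> : phi @^-1` A = phi @` A.
  apply/seteqP; split=> [k Ak|_ [k Ak <-]]; last by rewrite /= phiK.
  by exists (phi k).
have imK : phi @` (phi @` A) = A.
  apply/seteqP; split=> [_ [_ [k Ak <-] <-]|k Ak]; first by rewrite phiK.
  by exists (phi k) => //; exists k.
have eqA : (phi @` A #= A)%card.
  by rewrite card_eq_le card_image_le /= -{1}imK card_image_le.
rewrite /counting; have [finA|infA] := pselect (finite_set A).
  have finB : finite_set (phi @` A) by exact: finite_image.
  by rewrite !asboolT//; congr (_%:R%:E); exact/fcard_eq.
rewrite !asboolF// => finB; apply: infA.
by rewrite -imK; exact: finite_image.
Qed.

Lemma counting_le (A : set (lattice N)) (B : R) :
  (forall s : seq (lattice N), uniq s -> (forall k, k \in s -> A k) ->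
    (size s)%:R <= B) ->
  (counting A <= B%:E)%E.
Proof.
move=> AB; rewrite /counting; have [finA|infA] := pselect (finite_set A).
  rewrite asboolT// lee_fin; apply: AB; first exact: finmap.fset_uniq.
  by move=> k; rewrite in_fset_set// inE.
have B0 : 0 <= B by apply: (AB [::]).
have [F FA sF] := infinite_set_fset (Num.truncn B).+1 infA.
have := AB (finmap.enum_fset F) (finmap.fset_uniq F) (fun k kF => FA k kF).
rewrite leNgt => /negP[]; apply: lt_le_trans (truncnS_gt B) _.
by rewrite ler_nat.
Qed.

Lemma integral_zsub z (f : Z -> \bar R) : measurable_fun setT f ->
  (forall x, 0 <= f x)%E ->
  (\int[@dtaudk R N]_w f (zsub z w) = \int[@dtaudk R N]_w f w)%E.
Proof.
move=> mf f0.
have mphi : measurable_fun setT (zsub z).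
  exact: (measurable_fun_pair2 (f := fun p : Z * Z => zsub p.1 p.2) z measurable_zsub).
pose phi : {mfun Z >-> Z} :=
  HB.pack (zsub z) (isMeasurableFun.Build _ _ _ _ _ mphi).
have mu_phi (A : set Z) : measurable A ->
    @dtaudk R N A = pushforward (@dtaudk R N) phi A.
  move=> mA.
  apply: (product_measure_unique (m1 := lebesgue_measure) (m2 := @dk R N)
    (m' := pushforward (@dtaudk R N) phi)) => // B C mB mC.
  transitivity (@dtaudk R N
    (((fun x : measurableTypeR R => (z.1 : R) - x : measurableTypeR R) @^-1` B)
    `*` ((fun k : lattice N => z.2 - k) @^-1` C))); first by [].
  rewrite /dtaudk product_measure1E//.
  - congr (_ * _)%E; first exact: lebesgue_measure_reflect.
    by rewrite /dk /mscale; congr (_ * _)%E; exact: counting_reflect.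
  - rewrite -[X in measurable X]setTI.
    apply: (@measurable_funB _ _ R setT (cst (z.1 : R))
      (fun x : measurableTypeR R => x)) => //.
transitivity (\int[pushforward (@dtaudk R N) phi]_w f w)%E.
  by rewrite ge0_integral_pushforward// => y _; exact: f0.
by apply: eq_measure_integral => A mA _; exact/esym/mu_phi.
Qed.

End lattice_space.

(** * The trilinear form on the lattice *)

Section lattice_trilinear.
Context (R : realType) (N : nat).
Local Notation Z := (measurableTypeR R * lattice N)%type.
Local Open Scope ereal_scope.

Let sigma_finite_dtaudk : sigma_finite setT (@dtaudk R N).
Proof.
have [F TF Foo] := sigma_finiteT (@lebesgue_measure R).
have [G TG Goo] := sigma_finiteT (@dk R N).
exists (fun n => if unpickle n is Some ij then F ij.1 `*` G ij.2 else set0).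
  apply/seteqP; split=> // -[t k] _.
  have [i _ Fi] : (\bigcup_i F i) t by rewrite -TF.
  have [j _ Gj] : (\bigcup_i G i) k by rewrite -TG.
  by exists (pickle (i, j)) => //=; rewrite pickleK.
move=> n; case: (unpickle n) => [[i j]|] /=; last first.
  by split; [exact: measurable0|rewrite measure0].
have [mF Fi] := Foo i; have [mG Gj] := Goo j.
split; first exact: measurableX.
by rewrite /dtaudk product_measure1E// lte_mul_pinfty// ge0_fin_numE.
Qed.

HB.instance Definition _ :=
  Measure_isSigmaFinite.Build _ _ _ (@dtaudk R N) sigma_finite_dtaudk.

Local Notation mu := (@dtaudk R N).
Local Notation trilinear := (trilinear mu (@zsub R N)).

Definition zopp : Z -> Z := zsub (0%R : R, 0%R).

Lemma zoppB (z w : Z) : zopp (zsub z w) = zsub w z.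
Proof. by rewrite /zopp /zsub /= !sub0r !opprB. Qed.

Section symmetries.
Variables a b c : Z -> \bar R.
Hypotheses (ma : measurable_fun setT a) (mb : measurable_fun setT b)
  (mc : measurable_fun setT c).
Hypotheses (a0 : forall z, 0 <= a z) (b0 : forall z, 0 <= b z)
  (c0 : forall z, 0 <= c z).

Let m1 (f : Z -> \bar R) : measurable_fun setT f ->
  measurable_fun setT (fun p : Z * Z => f p.1).
Proof. by move=> mf; exact: (measurableT_comp mf measurable_fst). Qed.

Let m2 (f : Z -> \bar R) : measurable_fun setT f ->
  measurable_fun setT (fun p : Z * Z => f p.2).
Proof. by move=> mf; exact: (measurableT_comp mf measurable_snd). Qed.

Let ms (f : Z -> \bar R) : measurable_fun setT f ->
  measurable_fun setT (fun p : Z * Z => f (zsub p.1 p.2)).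
Proof. by move=> mf; exact: (measurableT_comp mf (@measurable_zsub R N)). Qed.

(** Exchanging the names of the two variables of integration moves the third
    function into the first place. *)
Lemma trilinear_exchange : trilinear a b c = trilinear c (b \o zopp) a.
Proof.
rewrite /trilinear (fubini_tonelli (m1 := mu) (m2 := mu)
  (fun p => a p.2 * b (zsub p.1 p.2) * c p.1))/=; last 2 first.
- by do !apply: emeasurable_funM; [exact: m2|exact: ms|exact: m1].
- by move=> p; rewrite !mule_ge0.
apply: eq_integral => z _; apply: eq_integral => w _.
by rewrite zoppB muleC [a z * _]muleC muleA.
Qed.

(** As above, followed by the substitution of [z - w] for [w]. *)
Lemma trilinear_rotate : trilinear a b c = trilinear c (a \o zopp) b.
Proof.
rewrite /trilinear [RHS](fubini_tonelli (m1 := mu) (m2 := mu)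
  (fun p => c p.2 * a (zopp (zsub p.1 p.2)) * b p.1))/=; last 2 first.
- do !apply: emeasurable_funM; [exact: m2| |exact: m1].
  apply: (ms (f := a \o zopp)); apply: (measurableT_comp ma).
  exact: (measurable_subr (@measurable_zsub R N)).
- by move=> p; rewrite !mule_ge0.
apply: eq_integral => z _.
rewrite -(@integral_zsub _ _ z (fun w => a w * b (zsub z w) * c z)).
- apply: eq_integral => w _.
  by rewrite zsubK zoppB muleC muleA.
- apply: emeasurable_funM; last exact: measurable_cst.
  apply: emeasurable_funM => //; apply: (measurableT_comp mb).
  exact: (measurable_subr (@measurable_zsub R N)).
- by move=> w; rewrite !mule_ge0.
Qed.

End symmetries.

(** The integral is taken fibrewise over the lattice.  On the fibre of [k] the
    variable [tau] is confined to an interval of length [2 * L3]; the fibre is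
    empty unless [k] satisfies the two conditions of the counting hypothesis,
    which result from eliminating [tau]. *)
Lemma triple_intersection_le (X1 X2 X3 : set Z)
    (psi1 psi2 psi3 : lattice N -> R) (L1 L2 L3 B : R) (w v : Z) :
  measurable X1 -> measurable X2 -> measurable X3 -> (0 <= L3)%R ->
  (forall z, X1 z -> `|(z.1 : R) - psi1 z.2| <= L1)%R ->
  (forall z, X2 z -> `|(z.1 : R) - psi2 z.2| <= L2)%R ->
  (forall z, X3 z -> `|(z.1 : R) - psi3 z.2| <= L3)%R ->
  (forall s : seq (lattice N), uniq s ->
    (forall k, k \in s -> `|psi1 (k - v.2) - psi3 k + v.1| <= L1 + L3 /\
                          `|psi2 (k - w.2) - psi3 k + w.1| <= L2 + L3)%R ->
    ((size s)%:R <= B)%R) ->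
  \int[mu]_z ((\1_X3 z)%:E * (\1_X2 (zsub z w))%:E * (\1_X1 (zsub z v))%:E)
    <= (2 * L3 * (N%:R ^- 2 * B))%:E.
Proof.
move=> mX1 mX2 mX3 L30 S1 S2 S3 count.
pose F z := (\1_X3 z)%:E * (\1_X2 (zsub z w))%:E * (\1_X1 (zsub z v))%:E : \bar R.
have mind (X : set Z) : measurable X ->
    measurable_fun setT (fun z : Z => (\1_X z)%:E : \bar R).
  by move=> mX; apply/measurable_EFinP; exact: measurable_indic.
have mF : measurable_fun setT F.
  apply: emeasurable_funM; first apply: emeasurable_funM; first exact: mind.
  - exact: (measurableT_comp (mind _ mX2) (measurable_subl (@measurable_zsub R N) w)).
  - exact: (measurableT_comp (mind _ mX1) (measurable_subl (@measurable_zsub R N) v)).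
have F0 z : 0 <= F z by rewrite !mule_ge0 ?lee_fin.
pose G := [set k : lattice N | `|psi1 (k - v.2) - psi3 k + v.1| <= L1 + L3 /\
                          `|psi2 (k - w.2) - psi3 k + w.1| <= L2 + L3]%R.
have FE t k : F (t, k) <= (\1_G k * \1_(`[psi3 k - L3, psi3 k + L3]%classic) t)%:E.
  rewrite /F -!EFinM lee_fin !indicE.
  have [|_] := boolP ((t, k) \in X3); last by rewrite !mul0r mulr_ge0.
  rewrite inE => /S3 /= tk3.
  have [|_] := boolP (zsub (t, k) w \in X2); last by rewrite mulr0 mul0r mulr_ge0.
  rewrite inE => /S2 /= tk2.
  have [|_] := boolP (zsub (t, k) v \in X1); last by rewrite mulr0 mulr_ge0.
  rewrite inE => /S1 /= tk1.
  rewrite !mem_set ?mulr1//.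
    by move: tk3; rewrite /= in_itv/= ler_norml; lra.
  by rewrite /G /=; split; move: tk1 tk2 tk3; rewrite !ler_norml; lra.
have mG : measurable_fun setT (fun k : lattice N => (2 * L3 * \1_G k)%:E : \bar R).
  by [].
rewrite (fubini_tonelli2 (m1 := lebesgue_measure) (m2 := @dk R N) F mF F0).
apply: (@le_trans _ _ (\int[@dk R N]_k (2 * L3 * \1_G k)%:E)).
  apply: ge0_le_integral => //.
  - by move=> k _; apply: integral_ge0.
  move=> k _; rewrite /fubini_G.
  apply: (@le_trans _ _ (\int[lebesgue_measure]_t
    ((\1_G k)%:E * (\1_(`[psi3 k - L3, psi3 k + L3]%classic) t)%:E))).
    apply: ge0_le_integral => //.
    + exact: (measurable_fun_pair1 k mF).
    + apply: emeasurable_funM; first exact: measurable_cst.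
      by apply/measurable_EFinP; exact: measurable_indic.
  rewrite ge0_integralZl//; last first.
    by apply/measurable_EFinP; exact: measurable_indic.
  have len : lebesgue_measure ([set` `[psi3 k - L3, psi3 k + L3]%R] : set R)
      <= (2 * L3)%:E.
    rewrite lebesgue_measure_itv/= lte_fin; case: ifP => _.
      by rewrite -EFinB lee_fin; lra.
    by rewrite lee_fin mulr_ge0.
  rewrite integral_indic// setIT mulrC EFinM.
  by apply: lee_wpmul2l => //; rewrite lee_fin.
under eq_integral do rewrite EFinM.
rewrite ge0_integralZl//; last by rewrite lee_fin mulr_ge0.
rewrite integral_indic// setIT [leRHS]EFinM.
apply: lee_wpmul2l; first by rewrite lee_fin mulr_ge0.
rewrite /dk /mscale [leRHS]EFinM; apply: lee_wpmul2l => //.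
by apply: counting_le => s us sG; apply: count.
Qed.

Lemma Lnorm2_sqr (f : Z -> R) :
  'N[mu]_2[EFin \o f] * 'N[mu]_2[EFin \o f] =
  \int[mu]_z (`|f z|%:E * `|f z|%:E).
Proof.
have int0 : 0 <= \int[mu]_z (`|f z|%:E * `|f z|%:E).
  by apply: integral_ge0 => z _; rewrite mule_ge0.
have -> : 'N[mu]_2[EFin \o f] = sqrte (\int[mu]_z (`|f z|%:E * `|f z|%:E)).
  rewrite unlock -poweR12_sqrt//; congr (_ `^ _); apply: eq_integral => z _ /=.
  by rewrite powR_mulrn// expr2.
by rewrite -[LHS]/(_ ^+ 2) sqr_sqrte.
Qed.

End lattice_trilinear.

(** * Bounds for functions supported near graphs *)

Section surfaces.
Context (R : realType) (N : nat).
Local Notation Z := (measurableTypeR R * lattice N)%type.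
Local Notation mu := (@dtaudk R N).
Local Notation trilinear := (trilinear mu (@zsub R N)).
Local Notation zopp := (@zopp R N).
Implicit Types (f : Z -> R) (psi : lattice N -> R).

Definition near_graph f psi (L : R) :=
  forall z, f z != 0 -> `|(z.1 : R) - psi z.2| <= L.

Local Notation abs f := (fun z => `|f z|%:E).
Local Notation mass f := (\int[mu]_z (`|f z|%:E * `|f z|%:E))%E.

Lemma near_graph_reflect f psi L : near_graph f psi L ->
  near_graph (f \o zopp) (fun k => - psi (- k)) L.
Proof.
move=> fpsi z /fpsi; rewrite /zopp /zsub /= !sub0r => h.
by rewrite -normrN opprB addrC.
Qed.

Lemma mass_reflect f : measurable_fun setT f -> mass (f \o zopp) = mass f.
Proof.
move=> mf.
rewrite -(@integral_zsub _ _ (0 : R, 0) (fun z => `|f z|%:E * `|f z|%:E)%E)//.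
- have mabs : measurable_fun setT (fun z => `|f z|%:E).
    by apply/measurable_EFinP; exact: measurableT_comp.
  exact: emeasurable_funM.
Qed.

(** Twice the constant [6 * (20 * G + 33)] of [size_intersection] at
    [G = 2 * M], which bounds the slopes of the differences; the factor two is
    that of the interval length [2 * L3]. *)
Definition slab_constant (M : R) : R := 12 * (20 * (2 * M) + 33).

(** The third function is the pivot.  The functions [psi_i] are multiplied by
    [N] to be in lattice units.  As [L3] is the smallest thickness, the widths
    [L_i + L3] are at most [2 * L_i], and two points of a strip differ by at
    most [4 * N * L_i]. *)
Lemma trilinear_pivot_bound (f1 f2 f3 : Z -> R) (psi1 psi2 psi3 : lattice N -> R)
    (Q1 Q2 Q3 : set 'rV[R]_2) (A delta M L1 L2 L3 : R) :
  measurable_fun setT f1 -> measurable_fun setT f2 -> measurable_fun setT f3 ->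
  near_graph f1 psi1 L1 -> near_graph f2 psi2 L2 -> near_graph f3 psi3 L3 ->
  has_slopes (fun m => N%:R * psi1 m) Q1 delta ->
  has_slopes (fun m => N%:R * psi2 m) Q2 delta ->
  has_slopes (fun m => N%:R * psi3 m) Q3 delta ->
  transversal Q1 Q2 Q3 A ->
  (forall q j, Q1 q -> `|q 0 j| <= M) ->
  (forall q j, Q2 q -> `|q 0 j| <= M) ->
  (forall q j, Q3 q -> `|q 0 j| <= M) ->
  1 <= A -> 0 <= delta -> A * (2 * delta) <= 1 / 64 ->
  0 <= L3 -> L3 <= L1 -> L3 <= L2 ->
  (trilinear (abs f1) (abs f2) (abs f3) * trilinear (abs f1) (abs f2) (abs f3) <=
  (slab_constant M * N%:R ^- 2 * (L3 *
    ((1 + 4 * (N%:R * Num.min L1 L2)) * (1 + 4 * (A * N%:R * Num.max L1 L2)))))%:E *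
  (mass f1 * mass f2 * mass f3))%E.
Proof.
move=> mf1 mf2 mf3 S1 S2 S3 P1 P2 P3 trans M1 M2 M3 A1 d0 Ad L30 L31 L32.
have mabs f : measurable_fun setT f -> measurable_fun setT (fun z => `|f z|%:E).
  by move=> mf; apply/measurable_EFinP; exact: measurableT_comp.
pose X f := [set z | f z != 0].
have mX f : measurable_fun setT f -> measurable (X f).
  move=> mf; rewrite (_ : X f = f @^-1` (~` [set 0])).
    by rewrite -[Y in measurable Y]setTI; apply: mf => //; exact: measurableC.
  by apply/seteqP; split=> z /= /eqP.
pose x f z : \bar R := (\1_(X f) z)%:E.
have mx f : measurable_fun setT f -> measurable_fun setT (x f).
  by move=> mf; apply/measurable_EFinP; apply: measurable_indic; exact: mX.
have x0 f z : (0 <= x f z)%E by rewrite lee_fin.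
have xx f z : (x f z * x f z = x f z)%E.
  by rewrite /x -EFinM indicE; case: (_ \in _); rewrite ?mulr1 ?mulr0.
have fx f z : (`|f z|%:E * x f z = `|f z|%:E)%E.
  rewrite /x -EFinM indicE; have [fz|fz] := boolP (f z == 0).
    by rewrite (eqP fz) normr0 mul0r.
  by rewrite mem_set// mulr1.
have N0 : 0 <= N%:R :> R by rewrite ler0n.
have A0 : 0 <= A by apply: le_trans A1.
have L10 : 0 <= L1 by apply: le_trans L31.
have L20 : 0 <= L2 by apply: le_trans L32.
pose B := 6 * (20 * (2 * M) + 33) *
  ((1 + Num.min (4 * (N%:R * L1)) (4 * (N%:R * L2))) *
   (1 + A * Num.max (4 * (N%:R * L1)) (4 * (N%:R * L2)))).
have count (a b : lattice N) (c d : R) (s : seq (lattice N)) : uniq s ->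
    (forall k, k \in s -> `|psi1 (k - a) - psi3 k + c| <= L1 + L3 /\
                          `|psi2 (k - b) - psi3 k + d| <= L2 + L3) ->
    (size s)%:R <= B.
  move=> us sU.
  have tr := has_slopes_diff (has_slopes_shift a P1) (has_slopes_shift b P2) P3
    trans M1 M2 M3.
  have osc (u v e L : R) : `|u + e| <= L + L3 -> `|v + e| <= L + L3 -> L3 <= L ->
      `|N%:R * v - N%:R * u| <= 4 * (N%:R * L).
    move=> ue ve LL; rewrite -mulrBr normrM ger0_norm// mulrCA ler_wpM2l//.
    by move: ue ve; rewrite !ler_norml; lra.
  apply: (size_intersection tr) => //.
  - by rewrite mulr_ge0.
  - by rewrite !mulr_ge0.
  - by rewrite !mulr_ge0.
  - move=> m n ms ns; rewrite -!mulrBr.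
    have [mU _] := sU m ms; have [nU _] := sU n ns.
    by rewrite mulrBr; exact: (osc _ _ c).
  - move=> m n ms ns; rewrite -!mulrBr.
    have [_ mU] := sU m ms; have [_ nU] := sU n ns.
    by rewrite mulrBr; exact: (osc _ _ d).
have M0 : 0 <= M.
  have [D DP] := P1; have [[q [Qq _ _]] _] := DP 0 0.
  exact: le_trans (normr_ge0 _) (M1 q 0 Qq).
have l0 : 0 <= Num.min L1 L2 by rewrite le_min L10.
have h0 : 0 <= Num.max L1 L2 by rewrite le_max L10.
have -> : slab_constant M * N%:R ^- 2 * (L3 * ((1 + 4 * (N%:R * Num.min L1 L2)) *
    (1 + 4 * (A * N%:R * Num.max L1 L2)))) = 2 * L3 * (N%:R ^- 2 * B).
  rewrite /B /slab_constant.
  have -> : Num.min (4 * (N%:R * L1)) (4 * (N%:R * L2)) =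
      4 * (N%:R * Num.min L1 L2) by rewrite -!minr_pMr.
  have -> : Num.max (4 * (N%:R * L1)) (4 * (N%:R * L2)) =
      4 * (N%:R * Num.max L1 L2) by rewrite -!maxr_pMr.
  by ring.
apply: (trilinear_cauchy_schwarz (@measurable_zsub R N) (@zsubK R N) (@integral_zsub R N)
   (mabs _ mf1) (mabs _ mf2) (mabs _ mf3) (mx _ mf1) (mx _ mf2) (mx _ mf3)) => //.
- rewrite lee_fin; apply: mulr_ge0; first by rewrite mulr_ge0.
  apply: mulr_ge0; first by rewrite invr_ge0 exprn_ge0.
  by apply: le_trans (count 0 0 0 0 [::] isT _); rewrite ?ler0n.
- move=> w v; apply: (triple_intersection_le (mX _ mf1) (mX _ mf2) (mX _ mf3)
    L30 S1 S2 S3).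
  by move=> s us; exact: count.
Qed.

Lemma transversal_rev (Q1 Q2 Q3 : set 'rV[R]_2) A :
  transversal Q1 Q2 Q3 A -> transversal Q3 Q2 Q1 A.
Proof.
move=> tr q3 q2 q1 Q3q Q2q Q1q; have := tr q1 q2 q3 Q1q Q2q Q3q.
rewrite -normrN (_ : - cross _ _ = cross (q3 - q1) (q2 - q1))//.
by rewrite /cross !mxE; ring.
Qed.

Lemma transversal_rot (Q1 Q2 Q3 : set 'rV[R]_2) A :
  transversal Q1 Q2 Q3 A -> transversal Q3 Q1 Q2 A.
Proof.
move=> tr q3 q1 q2 Q3q Q1q Q2q; have := tr q1 q2 q3 Q1q Q2q Q3q.
rewrite (_ : cross _ _ = cross (q3 - q2) (q1 - q2))//.
by rewrite /cross !mxE; ring.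
Qed.

Lemma Lsort_pivot (L : 'I_3 -> R) (i j k : 'I_3) :
  perm_eq [:: i; j; k] (enum 'I_3) -> L i <= L j -> L i <= L k ->
  [/\ Lmin L = L i, Lmed L = Num.min (L j) (L k) & Lmax L = Num.max (L j) (L k)].
Proof.
move=> ijk ij ik.
have sortE : sort <=%R (codom L) = [:: L i; Num.min (L j) (L k); Num.max (L j) (L k)].
  apply: (@sorted_eq _ <=%R).
  - exact: le_trans.
  - exact: le_anti.
  - exact: sort_le_sorted.
  - by rewrite /= le_min ij ik /= andbT; case: (leP (L j) (L k)) => // /ltW.
  rewrite perm_sort; apply: (@perm_trans _ [seq L x | x <- [:: i; j; k]]).
    by rewrite perm_sym; exact: perm_map.
  rewrite /=.
  have [_|_] := leP (L j) (L k) => //.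
  by rewrite perm_cons -[[:: L j; L k]]/([:: L j] ++ [:: L k]) perm_catC.
by rewrite /Lmin /Lmed /Lmax /Lsort sortE.
Qed.

(** In each case the index of the smallest thickness is brought into the third
    place; the function that this leaves in the second place is reflected. *)
Lemma trilinear_bound (f : 'I_3 -> Z -> R) (psi : 'I_3 -> lattice N -> R)
    (Q : 'I_3 -> set 'rV[R]_2) (A delta M : R) (L : 'I_3 -> R) :
  (forall i, measurable_fun setT (f i)) ->
  (forall i, near_graph (f i) (psi i) (L i)) ->
  (forall i, has_slopes (fun m => N%:R * psi i m) (Q i) delta) ->
  transversal (Q 0) (Q 1) (Q 2) A ->
  (forall i q j, Q i q -> `|q 0 j| <= M) ->
  1 <= A -> 0 <= delta -> A * (2 * delta) <= 1 / 64 ->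
  (forall i, 0 <= L i) ->
  (trilinear (abs (f 0)) (abs (f 1)) (abs (f 2)) *
   trilinear (abs (f 0)) (abs (f 1)) (abs (f 2)) <=
  (slab_constant M * N%:R ^- 2 * (Lmin L *
    ((1 + 4 * (N%:R * Lmed L)) * (1 + 4 * (A * N%:R * Lmax L)))))%:E *
  (mass (f 0) * mass (f 1) * mass (f 2)))%E.
Proof.
move=> mf Sf slope tr QM A1 d0 Ad L0.
have mabs i : measurable_fun setT (abs (f i)).
  by apply/measurable_EFinP; exact: measurableT_comp.
have reflect i : has_slopes (fun m => N%:R * - psi i (- m)) (Q i) delta.
  have := has_slopes_reflect (slope i); congr has_slopes.
  by apply/funext => m; rewrite mulrN.
have mreflect i : measurable_fun setT (f i \o zopp).
  apply: measurableT_comp => //.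
  exact: (measurable_subr (@measurable_zsub R N)).
have absreflect i : (abs (f i) \o zopp) = abs (f i \o zopp) by [].
have Sreflect i := near_graph_reflect (Sf i).
have [/andP[l20 l21]|] := boolP ((L 2 <= L 0) && (L 2 <= L 1)).
  have [|-> -> ->] := @Lsort_pivot L 2 0 1 _ l20 l21.
    by apply: uniq_perm; rewrite ?enum_uniq// => i; rewrite mem_enum;
       case: i => -[|[|[|//]]] ?; rewrite !inE.
  by apply: trilinear_pivot_bound => //; move=> q j; exact: QM.
rewrite negb_and -!ltNge => l2.
have [l01|/ltW l10] := leP (L 0) (L 1).
  have l02 : L 0 <= L 2 by case/orP: l2 => [/ltW//|/ltW]; exact: le_trans.
  have [|-> -> ->] := @Lsort_pivot L 0 2 1 _ l02 l01.
    by apply: uniq_perm; rewrite ?enum_uniq// => i; rewrite mem_enum;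
       case: i => -[|[|[|//]]] ?; rewrite !inE.
  rewrite trilinear_exchange// absreflect.
  have -> : (mass (f 0) * mass (f 1) * mass (f 2) =
      mass (f 2) * mass (f 1 \o zopp) * mass (f 0))%E.
    by rewrite mass_reflect// muleC [(mass (f 0%R) * _)%E]muleC muleA.
  by apply: (trilinear_pivot_bound _ _ _ _ _ _ _ (reflect 1) _ (transversal_rev tr)) => //;
    move=> q j; exact: QM.
have l12 : L 1 <= L 2 by case/orP: l2 => [/ltW|/ltW//]; exact: le_trans.
have [|-> -> ->] := @Lsort_pivot L 1 2 0 _ l12 l10.
  by apply: uniq_perm; rewrite ?enum_uniq// => i; rewrite mem_enum;
     case: i => -[|[|[|//]]] ?; rewrite !inE.
rewrite trilinear_rotate// absreflect.
have -> : (mass (f 0) * mass (f 1) * mass (f 2) =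
    mass (f 2) * mass (f 0 \o zopp) * mass (f 1))%E.
  by rewrite mass_reflect// muleC muleA.
by apply: (trilinear_pivot_bound _ _ _ _ _ _ _ (reflect 0) _ (transversal_rot tr)) => //;
    move=> q j; exact: QM.
Qed.

End surfaces.

(** * Gradients and normals of the graphs *)

Section euclidean_norm.
Context (R : realType) (n : nat).
Implicit Types u : 'rV[R]_n.

Lemma abs_le_enorm u i : `|u 0 i| <= enorm u.
Proof.
rewrite -sqrtr_sqr /enorm ler_sqrt; last by rewrite sumr_ge0// => j _; rewrite -expr2 sqr_ge0.
rewrite /dotp (bigD1 i)//= -expr2 lerDl sumr_ge0// => j _.
by rewrite -expr2 sqr_ge0.
Qed.

Lemma enorm_le_sum u : enorm u <= \sum_i `|u 0 i|.
Proof.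
have s0 : 0 <= \sum_i `|u 0 i| by rewrite sumr_ge0.
rewrite -[leRHS]ger0_norm// -sqrtr_sqr /enorm ler_sqrt ?sqr_ge0//.
rewrite /dotp expr2 mulr_suml ler_sum// => i _.
rewrite (le_trans (ler_norm _))// normrM ler_wpM2l//.
by rewrite (bigD1 i)//= lerDl sumr_ge0.
Qed.

End euclidean_norm.

Section graphs.
Context (R : realType).
Implicit Types (psi : 'rV[R]_2 -> R) (x y v : 'rV[R]_2).

Lemma row_mx0 (a : R) v : (row_mx a%:M v : 'rV[R]_3) 0 (lshift 2 (0 : 'I_1)) = a.
Proof.
rewrite -[RHS](_ : (a%:M : 'M[R]_1) 0 0 = a); first exact: (@row_mxEl _ 1 1 2).
by rewrite mxE eqxx mulr1n.
Qed.

Lemma row_mxS (a : R) v j : (row_mx a%:M v : 'rV[R]_3) 0 (rshift 1 j) = v 0 j.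
Proof. exact: (@row_mxEr _ 1 1 2). Qed.

Lemma dotp2 v : dotp v v = v 0 0 * v 0 0 + v 0 1 * v 0 1.
Proof.
by rewrite /dotp !big_ord_recl big_ord0 addr0 (_ : lift _ _ = 1)//; exact/val_inj.
Qed.

Lemma sum3 (F : 'I_3 -> R) :
  \sum_i F i = F (lshift 2 (0 : 'I_1)) + (F (rshift 1 0) + F (rshift 1 1)).
Proof.
rewrite !big_ord_recl big_ord0 addr0.
by congr (F _ + (F _ + F _)); exact/val_inj.
Qed.

Definition norm1 v : R := `|v 0 0| + `|v 0 1|.

Lemma derive_grad psi x v : differentiable psi x ->
  'D_v psi x = grad psi x 0 0 * v 0 0 + grad psi x 0 1 * v 0 1.
Proof.
move=> dpsi; rewrite deriveE// !mxE !deriveE//.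
have {1}-> : v = v 0 0 *: delta_mx 0 0 + v 0 1 *: delta_mx 0 1.
  by rewrite [LHS]row_sum_delta !big_ord_recl big_ord0 addr0; congr (_ + _ *: delta_mx _ _);
     try congr (v _ _); exact/val_inj.
by rewrite linearD !linearZ /= ![_ *: _]mulrC.
Qed.

Lemma mean_value psi x y : (forall z, differentiable psi z) ->
  exists2 t : R, 0 <= t <= 1 &
    let z := x + t *: (y - x) in
    psi y - psi x = grad psi z 0 0 * (y 0 0 - x 0 0) + grad psi z 0 1 * (y 0 1 - x 0 1).
Proof.
move=> dpsi; set w := y - x.
pose g (t : R) := psi (x + t *: w).
have dg (t : R) : is_derive t (1 : R) g ('D_w psi (x + t *: w)).
  have quot : (fun h : R => h^-1 *: ((g \o shift t) (h *: (1 : R)) - g t)) =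
      (fun h : R => h^-1 *: ((psi \o shift (x + t *: w)) (h *: w) - psi (x + t *: w))).
    apply/funext => h; congr (_ *: (_ - _)); rewrite /g /=; congr psi.
    by rewrite scalerDl addrCA /GRing.scale /= mulr1.
  have dw : derivable psi (x + t *: w) w by exact: diff_derivable.
  split; first by rewrite /derivable quot.
  by rewrite /derive quot.
have [] := @MVT_segment R g (fun t => 'D_w psi (x + t *: w)) 0 1 ler01.
  apply: derivable_within_continuous => t _.
  exact: (@ex_derive _ _ _ _ _ _ _ (dg t)).
move=> t; rewrite in_itv/= => t01 gt; exists t => //=.
move: gt; rewrite subr0 mulr1 /g scale1r scale0r addr0 /w (addrC x) subrK => ->.
by rewrite derive_grad// !mxE.
Qed.

Section gauss_map.
Variables (psi : 'rV[R]_2 -> R) (nu : 'rV[R]_3 -> 'rV[R]_3) (b M : R).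
Hypotheses (M0 : 0 <= M) (b0 : 0 <= b).
Hypothesis dpsi : forall x, differentiable psi x.
Hypothesis gradM : forall x, enorm (grad psi x) <= M.
Hypothesis normal : unit_normal_field psi nu.
Hypothesis curv : normal_bound psi nu b.

(* The normal is split into its components along the [tau] axis and along the
   plane. *)
Let vert x := nu (graph_pt psi x) 0 (lshift 2 (0 : 'I_1)).
Let horiz x (j : 'I_2) := nu (graph_pt psi x) 0 (rshift 1 j).

Lemma horizE x j : horiz x j = - (vert x * grad psi x 0 j).
Proof.
have [_ /(_ (delta_mx 0 j))] := normal x.
rewrite /dotp sum3 row_mx0 !row_mxS !mxE eqxx /=.
by have [->|->] := ord2 j; rewrite /= ?mulr0 ?mulr1 ?addr0 ?add0r;
   move=> /eqP; rewrite addrC addr_eq0 => /eqP.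
Qed.

(** The horizontal part of the normal is [- vert x] times the gradient, so that
    [1 = vert x ^ 2 * (1 + |grad psi x| ^ 2)]: a bounded gradient keeps the
    normal away from the horizontal. *)
Lemma vert_bounds x : `|vert x| <= 1 /\ 1 <= vert x ^+ 2 * (1 + M ^+ 2).
Proof.
have [n1 _] := normal x; split.
  by rewrite -n1; exact: abs_le_enorm.
have g2 : grad psi x 0 0 ^+ 2 + grad psi x 0 1 ^+ 2 <= M ^+ 2.
  have := gradM x; rewrite /enorm -(ler_pXn2r (n := 2))// ?nnegrE ?sqrtr_ge0//.
  rewrite sqr_sqrtr; last by rewrite sumr_ge0// => j _; rewrite -expr2 sqr_ge0.
  by rewrite dotp2 -!expr2.
have := congr1 (fun r => r ^+ 2) n1; rewrite expr1n /enorm sqr_sqrtr; last first.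
  by rewrite sumr_ge0// => j _; rewrite -expr2 sqr_ge0.
rewrite /dotp sum3 -/(vert x) -!/(horiz x _) !horizE => sqr1.
have := ler_wpM2l (sqr_ge0 (vert x)) g2; lra.
Qed.

Lemma grad_entry_le x j : `|grad psi x 0 j| <= M.
Proof. by apply: le_trans (gradM x); exact: abs_le_enorm. Qed.

Lemma graph_dist x y : enorm (graph_pt psi x - graph_pt psi y) <=
  (M + 1) * norm1 (x - y).
Proof.
apply: le_trans (enorm_le_sum _) _.
rewrite sum3 ![(_ - _ : 'rV[R]_3) _ _]mxE ![(- _ : 'rV[R]_3) _ _]mxE.
rewrite /graph_pt !row_mx0 !row_mxS mulrDl mul1r /norm1 !mxE.
rewrite lerD2r.
have [t _ /= ->] := mean_value y x dpsi.
apply: le_trans (ler_normD _ _) _; rewrite !normrM mulrDr.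
by rewrite lerD// ler_wpM2r// grad_entry_le.
Qed.

Lemma normal_dist x y :
  enorm (nu (graph_pt psi x) - nu (graph_pt psi y)) <= b * ((M + 1) * norm1 (x - y)).
Proof.
set s := graph_pt psi x; set t := graph_pt psi y.
have n0 : 0 <= norm1 (x - y) by rewrite addr_ge0.
have [->|st] := eqVneq s t.
  rewrite subrr /enorm /dotp big1 ?sqrtr0; last by move=> i _; rewrite mxE mul0r.
  by rewrite mulr_ge0// mulr_ge0// addr_ge0.
have := curv (s := s) (t := t) (ex_intro2 _ _ x I erefl) (ex_intro2 _ _ y I erefl) st.
have E0 : 0 < enorm (s - t).
  rewrite lt_neqAle sqrtr_ge0 andbT; apply: contra_neq st => E.
  apply/rowP => i; apply/eqP; rewrite -subr_eq0 -normr_le0.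
  by have := abs_le_enorm (s - t) i; rewrite -E !mxE.
move=> h; apply: (@le_trans _ _ (b * enorm (s - t))); last first.
  by rewrite ler_wpM2l// graph_dist.
rewrite -ler_pdivrMr//; apply: le_trans h.
by rewrite lerDl divr_ge0// sqr_ge0.
Qed.

Definition grad_lipschitz_constant := 2 * b * (M + 1) * (1 + M ^+ 2).

(** The gradient is minus the quotient of the horizontal part of the normal by
    its vertical part.  Both parts are Lipschitz and the second one is bounded
    below.  The quotient does not see the sign of the normal, so the
    orientation may be different at [x] and at [y]. *)
Lemma grad_lipschitz x y j :
  `|grad psi x 0 j - grad psi y 0 j| <= grad_lipschitz_constant * norm1 (x - y).
Proof.
have [vx1 vx2] := vert_bounds x; have [vy1 vy2] := vert_bounds y.
have nd := normal_dist x y.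
set E := b * _ in nd.
have dv : `|vert x - vert y| <= E.
  by have := abs_le_enorm (nu (graph_pt psi x) - nu (graph_pt psi y)) (lshift 2 (0 : 'I_1));
     rewrite !mxE => /le_trans; exact.
have dh : `|horiz x j - horiz y j| <= E.
  by have := abs_le_enorm (nu (graph_pt psi x) - nu (graph_pt psi y)) (rshift 1 j);
     rewrite !mxE => /le_trans; exact.
have hy : `|horiz y j| <= 1.
  by have [<- _] := normal y; exact: abs_le_enorm.
have vv : 1 <= `|vert x * vert y| * (1 + M ^+ 2).
  have M2 : 0 <= 1 + M ^+ 2 by rewrite addr_ge0// sqr_ge0.
  rewrite -(ler_pXn2r (n := 2))// ?nnegrE ?mulr_ge0// expr1n exprMn real_normK ?num_real//.
  have -> : (vert x * vert y) ^+ 2 * (1 + M ^+ 2) ^+ 2 =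
    (vert x ^+ 2 * (1 + M ^+ 2)) * (vert y ^+ 2 * (1 + M ^+ 2)) by ring.
  by rewrite -[leLHS]mulr1 ler_pM.
have key : (grad psi x 0 j - grad psi y 0 j) * (vert x * vert y) =
    - (horiz x j - horiz y j) * vert y + horiz y j * (vert x - vert y).
  by rewrite !horizE; ring.
have up : `|grad psi x 0 j - grad psi y 0 j| * `|vert x * vert y| <= 2 * E.
  rewrite -normrM key (le_trans (ler_normD _ _))// !normrM normrN mulr_natl mulr2n.
  rewrite lerD//; first by rewrite -[leRHS]mulr1 ler_pM.
  by rewrite -[leRHS]mul1r ler_pM.
rewrite /grad_lipschitz_constant.
have -> : 2 * b * (M + 1) * (1 + M ^+ 2) * norm1 (x - y) = 2 * E * (1 + M ^+ 2).
  by rewrite /E; ring.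
apply: (@le_trans _ _ (`|grad psi x 0 j - grad psi y 0 j| *
    (`|vert x * vert y| * (1 + M ^+ 2)))).
  by rewrite -[leLHS]mulr1 ler_wpM2l.
by rewrite mulrA ler_wpM2r// addr_ge0// sqr_ge0.
Qed.

(** Scaling by [N] in both variables preserves gradients and divides their
    Lipschitz constant by [N]. *)
Lemma graph_has_slopes (N : nat) : (0 < N)%N ->
  has_slopes (fun m : lattice N => N%:R * psi (lattice_pt R m))
    (range (grad psi)) (grad_lipschitz_constant / N%:R).
Proof.
move=> N_gt0; have N0 : 0 < N%:R :> R by rewrite ltr0n.
pose pt (m : lattice N) := lattice_pt R m.
have ptB (m n : lattice N) j : pt n 0 j - pt m 0 j = (n 0 j - m 0 j)%:~R / N%:R.
  by rewrite !mxE intrB mulrBl.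
have dist (m n : lattice N) : norm1 (pt n - pt m) = dist1 R m n / N%:R.
  by rewrite /norm1 ![(_ - _ : 'rV_2) _ _]mxE ![(- _ : 'rV_2) _ _]mxE !ptB
    !normrM normfV (ger0_norm (ltW N0)) -mulrDl.
have c0 : 0 <= grad_lipschitz_constant.
  by rewrite /grad_lipschitz_constant !mulr_ge0// ?addr_ge0// sqr_ge0.
have norm1N v : norm1 (- v) = norm1 v by rewrite /norm1 !mxE !normrN.
exists (fun m => grad psi (pt m)) => m n; split; last first.
  move=> j; rewrite mulrAC -mulrA -dist -norm1N opprB.
  exact: grad_lipschitz.
have [t /andP[t0 t1] /= psiE] := mean_value (pt m) (pt n) dpsi.
set z := pt m + _ in psiE.
exists (grad psi z); split.
- by exists z.
- rewrite -mulrBr psiE !ptB /incr.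
  by field; rewrite gt_eqF.
- move=> j; rewrite mulrAC -mulrA -dist.
  apply: le_trans (grad_lipschitz z (pt m) j) _.
  rewrite ler_wpM2l// /z addrC addKr.
  rewrite /norm1 !mxE !normrM (ger0_norm t0) -mulrDr ler_piMl//.
Qed.

End gauss_map.

Lemma det33 (B : 'M[R]_3) :
  \det B = B 0 0 * (B 1 1 * B 2 2 - B 1 2 * B 2 1)
         - B 0 1 * (B 1 0 * B 2 2 - B 1 2 * B 2 0)
         + B 0 2 * (B 1 0 * B 2 1 - B 1 1 * B 2 0).
Proof.
rewrite (expand_det_row _ 0) !big_ord_recl big_ord0 /cofactor.
rewrite !(expand_det_row _ 0) !big_ord_recl !big_ord0 /cofactor !det_mx11 !mxE.
(* Entries are indexed by naturals, so that the indices of the cofactors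
   compute. *)
pose F k l := B (inord k) (inord l).
have BF i j : B i j = F i j by rewrite /F !inord_val.
rewrite !BF /= /bump /=.
rewrite !expr0 !expr1 /=.
ring.
Qed.

End graphs.

(** * The estimate *)

Section conclusion.
Context (R : realType).

(** Each normal is its vertical component, of modulus at most one, times
    [(1, - grad psi)]; dividing the determinant by these components can only
    increase its modulus. *)
Lemma normals_transversal (psi : 'I_3 -> 'rV[R]_2 -> R)
    (nu : 'I_3 -> 'rV[R]_3 -> 'rV[R]_3) (A : R) :
  (forall i, unit_normal_field (psi i) (nu i)) ->
  (forall s : 'I_3 -> 'rV[R]_3, (forall i, hypersurface (psi i) (s i)) ->
    A^-1 <= \det (\matrix_(i < 3) nu i (s i))) ->
  transversal (range (grad (psi 0))) (range (grad (psi 1))) (range (grad (psi 2))) A.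
Proof.
move=> normal detA _ _ _ [x0 _ <-] [x1 _ <-] [x2 _ <-].
pose x (i : 'I_3) := if i == 0 then x0 else if i == 1 then x1 else x2.
pose v i := nu i (graph_pt (psi i) (x i)) 0 (lshift 2 (0 : 'I_1)).
have v1 i : `|v i| <= 1.
  by have [<- _] := normal i (x i); exact: abs_le_enorm.
have := detA (fun i => graph_pt (psi i) (x i)) (fun i => ex_intro2 _ _ (x i) I erefl).
set B := \matrix_i _.
have B0 i : B i 0 = v i by rewrite mxE /v; congr (nu _ _ 0 _); exact/val_inj.
have B1 i : B i 1 = - (v i * grad (psi i) (x i) 0 0).
  rewrite -(horizE (normal i)) mxE; congr (nu _ _ 0 _); exact/val_inj.
have B2 i : B i 2 = - (v i * grad (psi i) (x i) 0 1).
  rewrite -(horizE (normal i)) mxE; congr (nu _ _ 0 _); exact/val_inj.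
have -> : \det B = v 0 * v 1 * v 2 *
    cross (grad (psi 0) x0 - grad (psi 2) x2) (grad (psi 1) x1 - grad (psi 2) x2).
  rewrite det33 !B0 !B1 !B2 /cross.
  rewrite ![(_ - _ : 'rV[R]_2) _ _]mxE ![(- _ : 'rV[R]_2) _ _]mxE /x /=.
  ring.
move=> h; apply: le_trans h _; apply: le_trans (ler_norm _) _.
rewrite normrM ler_piMl// !normrM.
by rewrite mulr_ile1 ?mulr_ge0// mulr_ile1.
Qed.

Lemma one_add4_le_jbracket (x : R) : 0 <= x -> 1 + 4 * x <= 5 * jbracket x.
Proof.
move=> x0; have j1 : 1 <= jbracket x.
  by rewrite -{1}sqrtr1 ler_sqrt ?lerDl ?sqr_ge0// addr_ge0// sqr_ge0.
have jx : x <= jbracket x.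
  by rewrite -{1}(ger0_norm x0) -sqrtr_sqr ler_sqrt ?lerDr// addr_ge0// sqr_ge0.
lra.
Qed.

Lemma Lsort_ge0 (L : 'I_3 -> R) i : (i < 3)%N -> (forall j, 0 <= L j) ->
  0 <= Lsort L i.
Proof.
move=> i3 L0; have : Lsort L i \in sort <=%R (codom L).
  by apply: mem_nth; rewrite size_sort size_codom card_ord.
by rewrite mem_sort => /codomP[j ->].
Qed.

Lemma Cconst_sqr_ge (A N : nat) (L : 'I_3 -> R) : (forall i, 0 <= L i) ->
  Lmin L * ((1 + 4 * (N%:R * Lmed L)) * (1 + 4 * (A%:R * N%:R * Lmax L))) <=
  25 * Cconst A N L ^+ 2.
Proof.
move=> L0.
have min0 : 0 <= Lmin L by exact: Lsort_ge0.
have med0 : 0 <= N%:R * Lmed L by rewrite mulr_ge0//; exact: Lsort_ge0.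
have max0 : 0 <= A%:R * N%:R * Lmax L by rewrite !mulr_ge0//; exact: Lsort_ge0.
rewrite /Cconst !exprMn !sqr_sqrtr ?sqrtr_ge0//.
set u := jbracket _; set v := jbracket _.
have -> : 25 * (Lmin L * u * v) = Lmin L * (5 * u * (5 * v)) by ring.
rewrite ler_wpM2l// ler_pM// ?one_add4_le_jbracket//.
- by rewrite addr_ge0// mulr_ge0.
- by rewrite addr_ge0// mulr_ge0.
Qed.

Lemma prod3_scale (c : R) (x : 'I_3 -> \bar R) :
  (\prod_(i < 3) (c%:E * x i) = (c ^+ 3)%:E * (x 0%R * x 1%R * x 2%R))%E.
Proof.
rewrite !big_ord_recl big_ord0 mule1.
have -> : lift ord0 (lift ord0 ord0) = 2 :> 'I_3 by exact/val_inj.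
have -> : lift ord0 ord0 = 1 :> 'I_3 by exact/val_inj.
rewrite [X in (_ * X = _)%E]muleACA [LHS]muleACA -[in RHS]muleA.
by congr (_ * _)%E; rewrite !exprS expr0 mulr1 !EFinM.
Qed.

Section convolution.
Variable N : nat.
Local Notation Z := (measurableTypeR R * lattice N)%type.
Local Notation mu := (@dtaudk R N).
Local Open Scope ereal_scope.

(** The convolution is measurable as the difference of the integrals of the
    positive and negative parts of its integrand. *)
Lemma conv_le_trilinear (f g h : Z -> R) :
  measurable_fun setT f -> measurable_fun setT g -> measurable_fun setT h ->
  `| \int[mu]_z (conv f g z * (h z)%:E) | <=
  trilinear mu (@zsub R N) (fun z => `|f z|%:E) (fun z => `|g z|%:E)
    (fun z => `|h z|%:E).
Proof.
move=> mf mg mh.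
pose F (p : Z * Z) : \bar R := (f p.2 * g (zsub p.1 p.2))%:E.
have mF : measurable_fun setT F.
  apply/measurable_EFinP; apply: measurable_funM.
  - exact: (measurableT_comp mf measurable_snd).
  - exact: (measurableT_comp mg (@measurable_zsub R N)).
have convE z : conv f g z = \int[mu]_w F (z, w) by [].
have mconv : measurable_fun setT (conv f g).
  rewrite (_ : conv f g = fun z =>
    \int[mu]_w F^\+ (z, w) - \int[mu]_w F^\- (z, w)); last first.
    by apply/funext => z; rewrite convE [LHS]integralE; congr (_ - _);
       apply: eq_integral => w _; rewrite !unlock.
  apply: emeasurable_funB.
  - by apply: (@measurable_fun_integral2 _ _ _ mu F^\+) => //; exact: measurable_funepos.
  - by apply: (@measurable_fun_integral2 _ _ _ mu F^\-) => //; exact: measurable_funeneg.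
have mhE : measurable_fun setT (fun z => (h z)%:E) by exact/measurable_EFinP.
apply: le_trans (le_abse_integral _ _ _) _ => //.
  exact: emeasurable_funM.
have mabsF z : measurable_fun setT (fun w => `|F (z, w)|).
  by apply: measurableT_comp => //; exact: (measurable_fun_pair2 z mF).
have triE z : \int[mu]_w (`|f w|%:E * `|g (zsub z w)|%:E * `|h z|%:E) =
    (\int[mu]_w `|F (z, w)|) * `|h z|%:E.
  rewrite -ge0_integralZr//; apply: eq_integral => w _.
  by rewrite /F /= normrM EFinM.
rewrite /trilinear; apply: ge0_le_integral => //.
- by apply: measurableT_comp => //; exact: emeasurable_funM.
- rewrite (_ : (fun _ => _) = (fun z => (\int[mu]_w `|F (z, w)|) * `|h z|%:E)).
    apply: emeasurable_funM; last first.
      by apply/measurable_EFinP; exact: measurableT_comp.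
    apply: (@measurable_fun_integral2 _ _ _ mu (fun p => `|F p|)) => //.
    exact: measurableT_comp.
  by apply/funext => z; exact: triE.
move=> z _; rewrite triE abseM; apply: lee_wpmul2r => //.
rewrite convE; apply: le_abse_integral => //.
exact: (measurable_fun_pair2 z mF).
Qed.

End convolution.

End conclusion.

Theorem proposition4p8 (R : realType) (b M : R) (b_gt0 : 0 < b)
    (M_gt0 : 0 < M) :
  exists c C0 : R, [/\ 0 < c, 0 < C0 &
    forall (A N : nat) (L : 'I_3 -> R)
      (f : 'I_3 -> measurableTypeR R * lattice N -> R)
      (psi : 'I_3 -> 'rV[R]_2 -> R) (nu : 'I_3 -> 'rV[R]_3 -> 'rV[R]_3),
    dyadic A -> dyadic N -> A%:R <= c * N%:R ->
    (forall i, 0 < L i) ->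
    (forall i, measurable_fun setT (f i)) ->
    (forall i, C11 (psi i)) ->
    (forall i xi, enorm (grad (psi i) xi) <= M) ->
    (forall i, unit_normal_field (psi i) (nu i)) ->
    (forall i, normal_bound (psi i) (nu i) b) ->
    (forall s : 'I_3 -> 'rV[R]_3, (forall i, hypersurface (psi i) (s i)) ->
      A%:R^-1 <= \det (\matrix_(i < 3) nu i (s i)) <= 1) ->
    (forall i, [set z | f i z != 0] `<=` thickening (psi i) (L i)) ->
    ((N%:R ^+ 4)%:E
       * `| \int[@dtaudk R N]_z (conv (f 0%R) (f 1%R) z * (f 2%R z)%:E) |
     <= (C0 * Cconst A N L)%:E
       * \prod_(i < 3) (N%:R%:E * 'N[@dtaudk R N]_2 [EFin \o f i]))%E].
Proof.
pose beta := grad_lipschitz_constant b M.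
have M2 : 0 < 1 + M ^+ 2 by rewrite ltr_wpDr// sqr_ge0.
have beta_gt0 : 0 < beta.
  by rewrite /beta /grad_lipschitz_constant !mulr_gt0// addr_gt0.
have slab_gt0 : 0 < slab_constant M.
  by rewrite /slab_constant; lra.
(* The first constant turns [A <= c * N] into [A * (2 * beta / N) <= 1 / 64],
   the differences of two heights having slopes with Lipschitz constant
   [2 * beta / N]; the second one is the square root of
   [25 * slab_constant M], where [25] is the loss in replacing the factors
   [1 + 4 * x] by brackets. *)
exists (128 * beta)^-1, (5 * Num.sqrt (slab_constant M)); split.
- by rewrite invr_gt0 mulr_gt0.
- by rewrite mulr_gt0// sqrtr_gt0.
move=> A N L f psi nu [jA AE] [jN NE] AN L0 mf C11psi gradM normal curv det_nu suppf.
have A_gt0 : (0 < A)%N by rewrite AE expn_gt0.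
have N_gt0 : (0 < N)%N by rewrite NE expn_gt0.
have N0 : 0 < N%:R :> R by rewrite ltr0n.
have A1 : 1 <= A%:R :> R by rewrite ler1n.
have delta0 : 0 <= beta / N%:R by rewrite divr_ge0// ltW.
have Adelta : A%:R * (2 * (beta / N%:R)) <= 1 / 64.
  have -> : A%:R * (2 * (beta / N%:R)) = A%:R * (128 * beta) / N%:R / 64.
    by field; rewrite gt_eqF.
  rewrite ler_pM2r ?invr_gt0// ler_pdivrMr// mul1r -ler_pdivlMr.
    by rewrite mulrC.
  by rewrite pmulr_rgt0.
have trans : transversal (range (grad (psi 0))) (range (grad (psi 1)))
    (range (grad (psi 2))) A%:R.
  apply: (normals_transversal normal) => s /det_nu /andP[].
  by [].
have slopes i := graph_has_slopes (ltW M_gt0) (ltW b_gt0) (fun x => (C11psi i).1 x)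
  (gradM i) (normal i) (curv i) N_gt0.
have gradQ i q (j : 'I_2) : range (grad (psi i)) q -> `|q 0 j| <= M.
  by move=> [x _ <-]; exact: (grad_entry_le (gradM i)).
have near i : near_graph (f i) (fun m => psi i (lattice_pt R m)) (L i).
  by move=> z /suppf.
have := trilinear_bound mf near slopes trans gradQ A1 delta0 Adelta (fun i => ltW (L0 i)).
set T := trilinear _ _ _ _ _; rewrite -!Lnorm2_sqr.
set n0 := 'N[_]_2[EFin \o f 0%R]%E; set n1 := 'N[_]_2[EFin \o f 1%R]%E.
set n2 := 'N[_]_2[EFin \o f 2%R]%E => TT.
have T0 : (0 <= T)%E.
  by apply: integral_ge0 => z _; apply: integral_ge0 => w _; rewrite !mule_ge0.
have n00 : (0 <= n0)%E by exact: Lnorm_ge0.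
have n10 : (0 <= n1)%E by exact: Lnorm_ge0.
have n20 : (0 <= n2)%E by exact: Lnorm_ge0.
rewrite (prod3_scale _ (fun i => 'N[_]_2[EFin \o f i]%E)) -/n0 -/n1 -/n2.
have convT := conv_le_trilinear (mf 0) (mf 1) (mf 2).
apply: (@le_trans _ _ ((N%:R ^+ 4)%:E * T)%E).
  by apply: lee_wpmul2l convT; rewrite lee_fin exprn_ge0.
have Cc0 : 0 <= Cconst A N L by rewrite !mulr_ge0// sqrtr_ge0.
have N40 : 0 <= N%:R ^+ 4 :> R by rewrite exprn_ge0// ltW.
have N30 : 0 <= N%:R ^+ 3 :> R by rewrite exprn_ge0// ltW.
have C00 : 0 <= 5 * Num.sqrt (slab_constant M) by rewrite mulr_ge0// sqrtr_ge0.
have n012 : (0 <= n0 * n1 * n2)%E by rewrite !mule_ge0.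
(* Norms may be infinite, so the two sides are compared through their squares,
   where the squared norms form a common factor. *)
apply: lee_sqr.
- by rewrite mule_ge0// lee_fin.
- by rewrite !mule_ge0// lee_fin// mulr_ge0.
rewrite muleACA [leRHS]muleACA [X in (_ <= _ * X)%E]muleACA.
apply: (le_trans (lee_wpmul2l _ TT)); first by rewrite -EFinM lee_fin mulr_ge0.
have -> : (n0 * n1 * n2 * (n0 * n1 * n2) = n0 * n0 * (n1 * n1) * (n2 * n2))%E.
  by rewrite muleACA (muleACA n0).
have : (0 <= n0 * n0 * (n1 * n1) * (n2 * n2))%E by rewrite !mule_ge0.
move: (n0 * n0 * _ * _)%E => X X0; rewrite !muleA; apply: lee_wpmul2r => //.
rewrite -!EFinM lee_fin.
have sq : Num.sqrt (slab_constant M) ^+ 2 = slab_constant M.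
  by rewrite sqr_sqrtr// ltW.
have -> : 5 * Num.sqrt (slab_constant M) * Cconst A N L *
    (5 * Num.sqrt (slab_constant M) * Cconst A N L) * N%:R ^+ 3 * N%:R ^+ 3 =
    N%:R ^+ 6 * slab_constant M * (25 * Cconst A N L ^+ 2) by rewrite -{3}sq; ring.
set Y := Lmin L * _.
have -> : N%:R ^+ 4 * N%:R ^+ 4 * (slab_constant M * N%:R ^- 2 * Y) =
    N%:R ^+ 6 * slab_constant M * Y.
  by field; rewrite gt_eqF.
apply: ler_wpM2l (Cconst_sqr_ge A N (fun i => ltW (L0 i))).
by apply: mulr_ge0 (ltW slab_gt0); rewrite exprn_ge0// ltW.
Qed.
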